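(* Let $S=X\times Y$ be a compact Polish space (with $X,Y$ Polish), $\mu^*\in P(S)$, $\varepsilon\ge0$, $G\in\mathcal{G}$, and let $\mu^*_{Y|X}:X\to P(Y)$, $u\mapsto\mu^*_{Y|X=u}$, be a given Markov kernel. Assume that $c:S\times S\to\mathbb{R}_+$ is non-negative, continuous, and such that $c(s,r)=0$ if and only if $s=r$, and that $\ell(\cdot,G)$ is continuous. For every $(x,y)\in S$ let $$K_{(x,y)}=\{\mu_X\otimes\mu^*_{Y|X}\ :\ \mu_X\in P(X)\},$$ and suppose that $K_s$ is non-empty, weakly* closed and convex for $\mu^*$-a.e. $s\in S$ and that $\Omega_{K,c,\varepsilon}$ is non-empty. Then $$I_{\Omega_{K,c,\varepsilon}}(G)=\inf_{\lambda\ge0}\left(\lambda\varepsilon+\int_S\phi_{\lambda,G}(x,y)\,d\mu^*(x,y)\right),$$ where $$\phi_{\lambda,G}(x,y):=\sup_{u\in X}\left(\int_Y\Big[\ell(u,v,G)-\lambda c\big((x,y),(u,v)\big)\Big]\,d\mu^*_{Y|X=u}(v)\right).$$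
   Context: $P(S)$ is the set of Borel probability measures on $S$; weak* closedness in $P(S)$ refers to the duality with $C(S)$. $\mu_X\otimes\mu^*_{Y|X}$ denotes the probability measure $\mu_X(du)\,\mu^*_{Y|X=u}(dv)$ on $X\times Y$. $\mathcal{G}$ is a parameter space and $\ell:S\times\mathcal{G}\to[0,\infty)$ is a measurable loss function, written $\ell(u,v,G)$ for $\ell((u,v),G)$. The notation $\pi_{S|S}:S\to K_s$ means a $\mu^*$-measurable kernel $s\mapsto\pi_{S|S=s}\in P(S)$ such that $\pi_{S|S=s}\in K_s$ for $\mu^*$-a.e. $s\in S$. Define $$\Omega_{K,c,\varepsilon}:=\Big\{\pi_{S|S}:S\to K_s\ :\ \int_S\int_S c(s,r)\,d\pi_{S|S=s}(r)\,d\mu^*(s)\le\varepsilon\Big\},$$ $$I_{\Omega_{K,c,\varepsilon}}(G):=\sup_{\pi_{S|S}\in\Omega_{K,c,\varepsilon}}\int_S\int_S\ell(r,G)\,d\pi_{S|S=s}(r)\,d\mu^*(s).$$ *)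

(* Defs.v *)
From HB Require Import structures.
From mathcomp Require Import all_boot all_order all_algebra.
From mathcomp Require Import all_classical all_reals all_analysis.
From mathcomp Require Import measurable_realfun.

Set Implicit Arguments.
Unset Strict Implicit.
Unset Printing Implicit Defensive.

Import Order.TTheory GRing.Theory Num.Theory.
Import numFieldNormedType.Exports.

Local Open Scope classical_set_scope.
Local Open Scope ring_scope.

(* The library has both structures on products, but not their join. *)
HB.instance Definition _ (X Y : ptopologicalType) :=
  Pointed.on (X * Y)%type.

Definition separable_space (T : topologicalType) : Prop :=
  exists2 D : set T, countable D & dense D.

Definition complete_uniform (M : uniformType) : Prop :=
  forall F : set_system M, ProperFilter F -> cauchy F ->
    exists x : M, F --> x.

Definition homeomorphic (T U : topologicalType) : Prop :=
  exists f : T -> U, exists g : U -> T,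
    [/\ cancel f g, cancel g f, continuous f & continuous g].

Definition polish (R : realType) (T : topologicalType) : Prop :=
  separable_space T /\
  exists M : metricType R, complete_uniform M /\ homeomorphic M T.

(* T with its Borel sigma-algebra.  For a product, this is the sigma-algebra
   generated by the open sets of the product topology. *)
Definition borel (T : ptopologicalType) :
    measurableType (sigma_display (@open T)) :=
  g_sigma_algebraType (@open T).

Notation borel_prob S R := (probability (borel S) R).

Section weak_star.
Variables (R : realType) (S : ptopologicalType).

(* The weak* topology on P(S) is the initial topology for all the maps
   nu |-> \int f dnu with f in C(S). *)
Definition integral_eval (nu : borel_prob S R) :
    {ptws continuousType S R -> R} :=
  fun f => \int[nu]_s f s.

Definition weak_star_closed (K : set (borel_prob S R)) : Prop :=
  closed (K : set (initial_topology integral_eval)).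

(* Elements of [borel_prob S R] are set functions defined on all subsets of S
   but constrained on Borel sets only, so the mixture is characterised by its
   values on Borel sets. *)
Definition convex_subset (K : set (borel_prob S R)) : Prop :=
  forall (nu1 nu2 nu : borel_prob S R) (t : R),
    K nu1 -> K nu2 -> 0 <= t <= 1 ->
    (forall A : set (borel S), measurable A ->
       nu A = (t%:E * nu1 A + (1 - t)%:E * nu2 A)%E) ->
    K nu.

End weak_star.

Section kernels.
Variables (R : realType) (S : ptopologicalType) (mu : borel_prob S R).

(* Measurability for the mu-completion of the Borel sigma-algebra. *)
Definition mu_measurable_fun (f : S -> \bar R) : Prop :=
  forall B : set (\bar R), measurable B ->
    completed_algebra_gen mu (f @^-1` B).

Definition mu_measurable_kernel (pi : S -> borel_prob S R) : Prop :=
  forall A : set (borel S), measurable A -> mu_measurable_fun (fun s => pi s A).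

Variable K : S -> set (borel_prob S R).

Definition kernel_in (pi : S -> borel_prob S R) : Prop :=
  mu_measurable_kernel pi /\ {ae mu, forall s, K s (pi s)}.

Local Open Scope ereal_scope.

(* The inner integrals below are nonnegative and mu-measurable in s, possibly
   without being Borel measurable; on such functions [\int[mu]] (a supremum
   over the Borel simple functions below) is the integral with respect to the
   completion of mu. *)
Definition Omega (c : S -> S -> R) (eps : R) : set (S -> borel_prob S R) :=
  [set pi | kernel_in pi /\
    \int[mu]_s \int[pi s]_r (c s r)%:E <= eps%:E].

Definition I_Omega (T : Type) (l : S -> T -> R) (c : S -> S -> R) (eps : R)
    (G : T) : \bar R :=
  ereal_sup [set \int[mu]_s \int[pi s]_r (l r G)%:E | pi in Omega c eps].

End kernels.

Section structured.
Variables (R : realType) (X Y : ptopologicalType).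
Variable kap : R.-pker (borel X) ~> (borel Y).

Local Open Scope ereal_scope.

(* nu = muX (x) kap; [xsection A u] is [set v | (u, v) \in A]. *)
Definition is_kernel_product (muX : borel_prob X R)
    (nu : borel_prob (X * Y)%type R) : Prop :=
  forall A : set (borel (X * Y)%type), measurable A ->
    nu A = \int[muX]_u kap u (xsection A u).

Definition K_of (s : X * Y) : set (borel_prob (X * Y)%type R) :=
  [set nu | exists muX : borel_prob X R, is_kernel_product muX nu].

Definition phi (T : Type) (l : X * Y -> T -> R) (c : X * Y -> X * Y -> R)
    (lam : R) (G : T) (s : X * Y) : \bar R :=
  ereal_sup [set \int[kap u]_v (l (u, v) G - lam * c s (u, v))%:E
            | u in [set: X]].

End structured.

(* Main.v *)
Require Import Defs.
From HB Require Import structures.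
From mathcomp Require Import all_boot all_order all_algebra.
From mathcomp Require Import all_classical all_reals all_analysis.
From mathcomp Require Import measurable_realfun giry.
From mathcomp Require Import ring lra.

Set Implicit Arguments.
Unset Strict Implicit.
Unset Printing Implicit Defensive.

Import Order.TTheory GRing.Theory Num.Theory.
Import numFieldNormedType.Exports.

Local Open Scope classical_set_scope.
Local Open Scope ring_scope.

(* The kernel [Q u := delta_u (x) kap u] turns the problem into one on [X]: with
   [L u = \int l dQ_u] and [C s u = \int c(s, r) dQ_u(r)], every element of [K]
   is a mixture of the [Q u] and [phi_lam s = sup_u (L u - lam * C s u)].

   Weak* closedness of [K] forces [u |-> \int f dQ_u] to be continuous for [f]
   in C(S): by Riesz-Markov a limit of [Q u] along an ultrafilter converging to
   [u0] is a probability, it lies in [K], and its first marginal is the Dirac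
   mass at [u0], so it is [Q u0].  Hence [L] and [C s] are continuous on the
   compact space [X], the suprema are attained, and lexicographic minimisation
   yields measurable maximisers [sigma_lam].

   If the cost of [sigma_0] is at most [eps], [lam = 0] is optimal.  If the
   costs of the [sigma_lam] eventually drop to [eps], mix two selectors whose
   multipliers are close to the threshold.  Otherwise the costs stay above [eps]
   for arbitrarily large [lam], the dual value at [lam] is at most the reward of
   [sigma_lam], and these rewards tend to the reward of the selector that
   minimises the cost first and then maximises [L]; it is feasible since
   [Omega] is not empty. *)

(** * Polish spaces and their Borel sets *)

(** [d] is the distance to the complement of [U], read in [M] through the homeomorphism: it is
    1-Lipschitz for that metric, and positive on [U] because [U] contains a ball around each of its
    points. *)
Lemma open_cozero (R : realType) (M : metricType R) (S : topologicalType)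
    (U : set S) :
  homeomorphic M S -> open U ->
  exists d : S -> R, [/\ continuous d, forall x, 0 <= d x &
    forall x, 0 < d x <-> U x].
Proof.
move=> [f [g [fK gK cf cg]]] oU.
(* An infimum over the empty set carries no information, so [U] equal to the whole space gets the
   constant 1. *)
have [/eqP U0|/set0P[a0 Ua0]] := boolP (~` U == set0).
  exists (fun=> 1); split=> // x; first exact: cvg_cst.
  split=> // _; apply: contrapT => nUx.
  by have : (~` U) x by []; rewrite U0.
pose D (x : S) := [set mdist (g x) (g a) | a in ~` U].
have D0 x : D x !=set0 by exists (mdist (g x) (g a0)), a0.
have Dlb x : lbound (D x) 0 by move=> _ [a _ <-]; exact: mdist_ge0.
have Dinf x : has_inf (D x) by split=> //; exists 0.
have D_ge0 x : 0 <= inf (D x) by apply: lb_le_inf => //; exact: Dlb.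
have Dlip x y : inf (D x) <= mdist (g x) (g y) + inf (D y).
  rewrite -lerBlDl; apply: lb_le_inf => // _ [a Ua <-].
  rewrite lerBlDl (le_trans _ (metric_triangle _ (g y) _))//.
  by apply: ge_inf; [have [] := Dinf x|exists a].
have cD : continuous (fun x => inf (D x)).
  move=> x; apply/cvgrPdist_lt => e e0.
  have /cg : nbhs (g x) (ball (g x) e) by exact: nbhsx_ballx.
  apply: (@filterS _ (nbhs x)) => y; rewrite /= ballEmdist/= => xy.
  rewrite ltr_norml; have := Dlip x y; have := Dlip y x.
  rewrite (metric_sym (g y)) => ? ?; apply/andP; split; lra.
exists (fun x => inf (D x)); split=> // x; split=> [|Ux].
  move=> dx; apply: contrapT => nUx; move: dx; apply/negP; rewrite -leNgt;
    apply: ge_inf; first by have [] := Dinf x.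
  by exists x => //; rewrite mdistxx.
have : nbhs (f (g x)) U by rewrite gK; exact: open_nbhs_nbhs.
move=> /cf /= /nbhs_ballP[e /= e0 xeU].
apply: (lt_le_trans e0); apply: lb_le_inf => // _ [a nUa <-].
rewrite leNgt; apply/negP => ae; apply: nUa.
by rewrite -(gK a); apply: xeU; rewrite ballEmdist.
Qed.

Lemma separable_sequence (T : ptopologicalType) : separable_space T ->
  exists x : nat -> T, forall U, open U -> U !=set0 -> exists n, U (x n).
Proof.
move=> [D cD dD].
have D0 : D !=set0.
  have [|d [_ Dd]] := dD setT _ openT; first by exists point.
  by exists d.
have := cD; rewrite /countable => /pfcard_geP[D0'|[h]].
  by move: D0; rewrite D0' => -[].
exists h => U oU U0; have [d [Ud Dd]] := dD _ U0 oU.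
by have [n _ nd] := 'surj_h Dd; exists n; rewrite nd.
Qed.

Definition open_basis (T : topologicalType) (B : nat -> set T) :=
  (forall n, open (B n)) /\
  forall x U, open U -> U x -> exists n, B n x /\ B n `<=` U.

(** The basis consists of the balls of radius [1/(n+1)] around a dense sequence, enumerated through
    [pickle]; a number that codes no pair yields the empty set. *)
Lemma polish_basis (R : realType) (T : ptopologicalType) : polish R T ->
  exists B : nat -> set T, open_basis B.
Proof.
move=> [/separable_sequence[x xP] [M [_ [f [g [fK gK cf cg]]]]]].
pose B' (i : nat * nat) := [set y | mdist (g (x i.1)) (g y) < i.2.+1%:R^-1].
pose B k := if unpickle k is Some i then B' i else set0.
have oB' (z : T) r : open [set y | mdist (g z) (g y) < r].
  rewrite openE => y /= zyr.
  have : nbhs (g y) (ball (g y) (r - mdist (g z) (g y))).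
    by apply: nbhsx_ballx; rewrite subr_gt0.
  move/cg; apply: (@filterS _ (nbhs y)) => w; rewrite /= ballEmdist/= => yw.
  by rewrite (le_lt_trans (metric_triangle _ (g y) _))// -ltrBrDl.
exists B; split => [k|z U oU Uz].
  by rewrite /B; case: unpickle => [i|]; [exact: oB'|exact: open0].
have : nbhs (f (g z)) U by rewrite gK; exact: open_nbhs_nbhs.
move=> /cf /= /nbhs_ballP[e /= e0 zeU].
have [n ne] : exists n : nat, n.+1%:R^-1 < e / 2.
  have e20 : 0 < e / 2 by rewrite divr_gt0.
  by have [n] := ltr_add_invr e20; rewrite add0r => ?; exists n.
(* The ball of radius [1/(n+1)] around such a centre contains [z] and stays within [2/(n+1) < e] of
   it. *)
have [|m zm] := xP _ (oB' z n.+1%:R^-1); first by exists z; rewrite /= mdistxx.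
exists (pickle (m, n)); rewrite /B pickleK; split;
  first by rewrite /B'/= metric_sym.
move=> y /= my; rewrite -(gK y); apply: zeU; rewrite ballEmdist/=.
rewrite (le_lt_trans (metric_triangle _ (g (x m)) _))// [e]splitr ltrD//.
  exact: (lt_trans zm).
exact: (lt_trans my).
Qed.

Lemma continuous_borel_measurable (R : realType) (T : ptopologicalType)
    (f : T -> R) : continuous f -> measurable_fun [set: borel T] f.
Proof.
move=> /continuousP cf.
apply: (measurability _ (RGenOpens.measurableE R)) => _ [_ [a [b ->]] <-].
rewrite setTI; apply: sub_sigma_algebra; apply: cf; exact: interval_open.
Qed.

Lemma continuous_borel_borel (T U : ptopologicalType) (f : T -> U) :
  continuous f -> measurable_fun [set: borel T] (f : borel T -> borel U).
Proof.
move=> /continuousP cf.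
apply: (@measurability _ _ (borel T) (borel U) setT f (@open U)) =>
  // _ [A oA <-].
by rewrite setTI; apply: sub_sigma_algebra; exact: cf.
Qed.

(** Second countability enters here: an open subset of [T * U] is a countable union of basic
    rectangles. Tonelli and the sections of kernels work with the product sigma-algebra, while the
    probabilities live on the Borel one. *)
Lemma borel_prod_measurable (T U : ptopologicalType) (B : nat -> set T)
    (C : nat -> set U) (A : set (T * U)) :
  open_basis B -> open_basis C -> measurable (A : set (borel (T * U)%type)) ->
  measurable (A : set (borel T * borel U)).
Proof.
move=> [oB bB] [oC bC].
apply: (@smallest_sub _ (sigma_algebra setT) (@open (T * U)%type)
  (@measurable _ (borel T * borel U)%type)) => /=.
  exact: sigma_algebra_measurable.
move=> V oV.
pose F (i : nat * nat) := if `[< B i.1 `*` C i.2 `<=` V >] then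
  B i.1 `*` C i.2 else set0.
have -> : V = \bigcup_n \bigcup_m F (n, m).
  apply/seteqP; split => [[x y] Vxy|z [n _ [m _]]]; last first.
    by rewrite /F/=; case: asboolP => // + Hz; apply.
  have [[P Q] /= [Px Qy] PQV] : nbhs (x, y) V by exact: open_nbhs_nbhs.
  move: Px Qy; rewrite !nbhsE => -[P' [oP' P'x] P'P] [Q' [oQ' Q'y] Q'Q].
  have [n [Bnx BnP]] := bB _ _ oP' P'x; have [m [Cmy CmQ]] := bC _ _ oQ' Q'y.
  exists n => //; exists m => //; rewrite /F/=; case: asboolP =>
    // -[] [a b] /= [Ba Cb].
  by apply: PQV; split; [apply/P'P/BnP|apply/Q'Q/CmQ].
apply: bigcupT_measurable => n; apply: bigcupT_measurable => m.
rewrite /F/=; case: asboolP => _; last exact: measurable0.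
by apply: measurableX; apply: sub_sigma_algebra.
Qed.

Lemma continuous_prod_measurable (R : realType) (T U : ptopologicalType)
    (B : nat -> set T) (C : nat -> set U) (f : T * U -> R) :
  open_basis B -> open_basis C -> continuous f ->
  measurable_fun [set: borel T * borel U] f.
Proof.
move=> bB bC cf _ A mA; rewrite setTI; apply: (borel_prod_measurable bB bC).
by rewrite -[X in measurable X]setTI; exact: continuous_borel_measurable.
Qed.

Lemma probability_of_set_function d (T : measurableType d) (R : realType)
    (P0 : set T -> \bar R) :
  P0 set0 = 0%E -> (forall A, (0 <= P0 A)%E) ->
  semi_sigma_additive P0 -> P0 setT = 1%E ->
  exists P : probability T R, forall A, P A = P0 A.
Proof.
move=> P00 P0_ge0 P0s P01.
pose P1 : {measure set T -> \bar R} :=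
  HB.pack P0 (isMeasure.Build _ T R P0 P00 P0_ge0 P0s).
pose P : probability T R := HB.pack P0 (Measure.on P1)
  (Measure_isProbability.Build _ T R P1 P01).
by exists P.
Qed.

(** * Continuous real functions and compactness *)

Section continuous_real_functions.
Variables (R : realType) (T : topologicalType).
Implicit Types f g : T -> R.

Lemma continuous_maxr f g : continuous f -> continuous g ->
  continuous (fun x => Num.max (f x) (g x)).
Proof. by move=> cf cg x; apply: (@continuous_max R T f g);
  [exact: cf|exact: cg]. Qed.

Lemma continuous_minr f g : continuous f -> continuous g ->
  continuous (fun x => Num.min (f x) (g x)).
Proof. by move=> cf cg x; apply: (@continuous_min R T f g);
  [exact: cf|exact: cg]. Qed.

Lemma continuous_cst (r : R) : continuous (fun _ : T => r).
Proof. by move=> x; exact: cvg_cst. Qed.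

Lemma continuous_addr f g : continuous f -> continuous g ->
  continuous (fun x => f x + g x).
Proof. by move=> cf cg x; apply: cvgD; [exact: cf|exact: cg]. Qed.

Lemma continuous_subr f g : continuous f -> continuous g ->
  continuous (fun x => f x - g x).
Proof. by move=> cf cg x; apply: cvgB; [exact: cf|exact: cg]. Qed.

Lemma continuous_mulr f g : continuous f -> continuous g ->
  continuous (fun x => f x * g x).
Proof. by move=> cf cg x; apply: cvgM; [exact: cf|exact: cg]. Qed.

Lemma continuous_scaler (k : R) f : continuous f -> continuous (fun x =>
  k * f x).
Proof. by move=> cf; apply: continuous_mulr => //; exact: continuous_cst. Qed.

Lemma continuous_divr f g : continuous f -> continuous g ->
  (forall x, g x != 0) -> continuous (fun x => f x / g x).
Proof. by move=> cf cg g0 x; apply: cvgM; [exact: cf|apply: cvgV => //;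
  exact: cg]. Qed.

Lemma continuous_sumr (h : nat -> T -> R) n : (forall i, continuous (h i)) ->
  continuous (fun x => \sum_(i < n) h i x).
Proof.
move=> ch; elim: n => [|n ih].
  by under eq_fun do rewrite big_ord0; exact: continuous_cst.
by under eq_fun do rewrite big_ord_recr/=; exact: continuous_addr.
Qed.

Lemma continuous_open_gtr f r : continuous f -> open [set x | r < f x].
Proof.
move=> /continuousP cf; rewrite (_ : mkset _ = f @^-1` [set y | r < y])//.
by apply: cf; exact: open_gt.
Qed.

Lemma continuous_open_ltr f r : continuous f -> open [set x | f x < r].
Proof.
move=> /continuousP cf; rewrite (_ : mkset _ = f @^-1` [set y | y < r])//.
by apply: cf; exact: open_lt.
Qed.

Lemma continuous_closed_ger f r : continuous f -> closed [set x | r <= f x].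
Proof.
move=> /continuous_closedP cf;
  rewrite (_ : mkset _ = f @^-1` [set y | r <= y])//.
by apply: cf; exact: closed_ge.
Qed.

Lemma compact_bounded_continuous f : compact [set: T] -> continuous f ->
  exists B, 0 < B /\ forall x, `|f x| <= B.
Proof.
move=> cT cf; have /compact_bounded[N [_ Nb]] : compact (f @` setT).
  by apply: continuous_compact => //; exact: continuous_subspaceT.
exists (Num.max N 0 + 1); split; first by rewrite ltr_wpDl// le_max lexx orbT.
by move=> x; apply: (Nb (Num.max N 0 + 1));
  [rewrite ltr_pwDr// le_max lexx|exists x].
Qed.

End continuous_real_functions.

(** Typical use: a strict inequality [0 < f x] at each point yields some [k] with [1/(k+1) < f x],
    and compactness makes [k] uniform. *)
Lemma compact_increasing_cover (T : ptopologicalType) (K : set T)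
    (V : nat -> set T) : compact K -> (forall n, open (V n)) ->
  (forall m n, (m <= n)%N -> V m `<=` V n) -> K `<=` \bigcup_n V n ->
  exists n, K `<=` V n.
Proof.
rewrite compact_cover => cK oV ndV KV.
have [|D' _ D'K] := cK nat setT V _ KV; first by move=> i _; exact: oV.
exists (\max_(i <- finmap.enum_fset D') i)%N => x /D'K[i /= iD' Vix].
by apply: (ndV i) => //; exact: leq_bigmax_seq.
Qed.

(** * The Riesz-Markov theorem on compact spaces *)

Section riesz_outer_measure.
Variables (R : realType) (S : ptopologicalType) (Lam : (S -> R) -> R).
Hypothesis cptS : compact [set: S].
Hypothesis cozeroS : forall U : set S, open U ->
  exists d : S -> R, [/\ continuous d, forall x, 0 <= d x &
    forall x, 0 < d x <-> U x].
Hypothesis LamD : forall f g : S -> R, continuous f -> continuous g ->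
  Lam (fun x => f x + g x) = Lam f + Lam g.
Hypothesis LamZ : forall (k : R) (f : S -> R), continuous f ->
  Lam (fun x => k * f x) = k * Lam f.
Hypothesis Lam_ge0 : forall f : S -> R, continuous f -> (forall x, 0 <= f x) ->
  0 <= Lam f.
Hypothesis Lam1 : Lam (fun=> 1) = 1.

Lemma functional_cst (r : R) : Lam (fun=> r) = r.
Proof.
rewrite -[RHS]mulr1 -Lam1 -LamZ; last exact: continuous_cst.
by congr Lam; apply/funext => x; rewrite mulr1.
Qed.

Lemma functionalB (f g : S -> R) : continuous f -> continuous g ->
  Lam (fun x => f x - g x) = Lam f - Lam g.
Proof.
move=> cf cg; rewrite -[in RHS]mulN1r -LamZ// -LamD//;
  last exact: continuous_scaler.
by congr Lam; apply/funext => x; rewrite mulN1r.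
Qed.

Lemma le_functional (f g : S -> R) : continuous f -> continuous g ->
  (forall x, f x <= g x) -> Lam f <= Lam g.
Proof.
move=> cf cg fg; rewrite -subr_ge0 -functionalB//; apply: Lam_ge0.
  exact: continuous_subr.
by move=> x; rewrite subr_ge0.
Qed.

Lemma functional_sum (h : nat -> S -> R) n : (forall i, continuous (h i)) ->
  Lam (fun x => \sum_(i < n) h i x) = \sum_(i < n) Lam (h i).
Proof.
move=> ch; elim: n => [|n ih].
  by under eq_fun do rewrite big_ord0; rewrite functional_cst big_ord0.
under eq_fun do rewrite big_ord_recr/=.
by rewrite LamD ?ih ?big_ord_recr//; exact: continuous_sumr.
Qed.

(** Vanishing off [U] replaces the usual condition of compact support in [U]; the truncation
    [max (g - d) 0] recovers the latter up to an error [d]. The supremum [open_size U] will be the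
    measure of [U]. *)
Definition subordinate (U : set S) : set (S -> R) :=
  [set g : S -> R | [/\ continuous g, forall x, 0 <= g x <= 1 &
    forall x, ~ U x -> g x = 0]].

Definition open_size (U : set S) : R := sup [set Lam g | g in subordinate U].

Lemma subordinate0 U : subordinate U (fun=> 0).
Proof. by split=> //; [exact: continuous_cst|move=> x; rewrite lexx ler01]. Qed.

Lemma subordinate_le1 U g : subordinate U g -> Lam g <= 1.
Proof.
move=> [cg g01 _]; rewrite -Lam1; apply: le_functional => //.
  exact: continuous_cst.
by move=> x; have /andP[] := g01 x.
Qed.

Lemma has_sup_open_size U : has_sup [set Lam g | g in subordinate U].
Proof.
split; first by exists (Lam (fun=> 0)), (fun=> 0); [exact: subordinate0|].
by exists 1 => _ [g gU <-]; exact: subordinate_le1 gU.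
Qed.

Lemma open_size_ub U g : subordinate U g -> Lam g <= open_size U.
Proof. by move=> gU; apply: (ub_le_sup (has_sup_open_size U).2); exists g. Qed.

Lemma open_size_le U r : (forall g, subordinate U g -> Lam g <= r) ->
  open_size U <= r.
Proof.
move=> Ur; apply: ge_sup; first exact: (has_sup_open_size U).1.
by move=> _ [g gU <-]; exact: Ur.
Qed.

Lemma open_size_ge0 U : 0 <= open_size U.
Proof. by rewrite -[leLHS](functional_cst 0);
  exact/open_size_ub/subordinate0. Qed.

Lemma open_sizeS U V : U `<=` V -> open_size U <= open_size V.
Proof.
move=> UV; apply: open_size_le => g [cg g01 gU]; apply: open_size_ub; split=>
  //.
by move=> x nVx; apply: gU => /UV.
Qed.

Lemma open_size0 : open_size set0 = 0.
Proof.
apply/le_anti; rewrite open_size_ge0 andbT; apply: open_size_le => g [_ _ g0].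
rewrite (_ : g = fun=> 0) ?functional_cst//; apply/funext => x; exact: g0.
Qed.

Lemma open_sizeT : open_size setT = 1.
Proof.
apply/le_anti/andP; split; first by apply: open_size_le => g;
  exact: subordinate_le1.
rewrite -[leLHS]Lam1; apply: open_size_ub; split=> [|x|x []//];
  first exact: continuous_cst.
by rewrite lexx ler01.
Qed.

Lemma continuous_truncate (g : S -> R) d : continuous g ->
  continuous (fun x => Num.max (g x - d) 0).
Proof.
move=> cg; apply: continuous_maxr; last exact: continuous_cst.
by apply: continuous_subr => //; exact: continuous_cst.
Qed.

Lemma functional_truncate (g : S -> R) d : continuous g ->
  Lam g - d <= Lam (fun x => Num.max (g x - d) 0).
Proof.
move=> cg; rewrite -[d in leLHS]functional_cst -functionalB//;
  last exact: continuous_cst.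
apply: le_functional.
- by apply: continuous_subr => //; exact: continuous_cst.
- exact: continuous_truncate.
- by move=> x; rewrite le_max lexx.
Qed.

(* Partition of unity: [max (g - d) 0] is supported in the compact set [d <= g],
   where finitely many of the cozero functions of the [F i] have a sum bounded
   away from 0. *)
Lemma open_size_sigma_subadditive (F : nat -> set S) : (forall i, open (F i)) ->
  ((open_size (\bigcup_i F i))%:E <= \sum_(i <oo) (open_size (F i))%:E)%E.
Proof.
move=> oF; have [e eP] := choice (fun i => cozeroS (oF i)).
have ce i : continuous (e i) by case: (eP i).
have e_ge0 i x : 0 <= e i x by case: (eP i).
have e_gt0 i x : 0 < e i x <-> F i x by case: (eP i).
pose D n x := \sum_(i < n) e i x.
have cD n : continuous (D n) by exact: continuous_sumr.
have D_ge0 n x : 0 <= D n x by apply: sumr_ge0.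
have ndD x : {homo D ^~ x : m n / (m <= n)%N >-> m <= n}.
  apply/nondecreasing_seqP => n; rewrite /D big_ord_recr/= lerDl//.
set E := (\sum_(i <oo) _)%E.
have E_ge n : ((\sum_(i < n) open_size (F i))%:E <= E)%E.
  rewrite -sumEFin -(big_mkord xpredT (fun i => (open_size (F i))%:E)).
  by apply: nneseries_lim_ge => i _ _; rewrite lee_fin open_size_ge0.
(* The series may be infinite, so the left side is compared with real bounds of the partial sums. *)
suff H r : (forall n, \sum_(i < n) open_size (F i) <= r) ->
  open_size (\bigcup_i F i) <= r.
  move: E E_ge => [r Er||]; last 2 first.
  - by rewrite leey.
  - by move=> /(_ 0%N); rewrite leeNy_eq.
  by rewrite lee_fin; apply: H => n; rewrite -lee_fin.
move=> Fr; apply: open_size_le => g [cg g01 gF].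
apply/ler_addgt0Pr => d d0; rewrite -lerBlDr.
apply: (le_trans (functional_truncate d cg)).
have [||||n nP] := @compact_increasing_cover S [set x | d <= g x]
    (fun n => [set x | n.+1%:R^-1 < D n x]).
- by apply: (subclosed_compact _ cptS) => //; exact: continuous_closed_ger.
- by move=> n; exact: continuous_open_gtr.
- move=> m n mn x /= mx; rewrite (le_lt_trans _ (lt_le_trans mx (ndD _ _ _
  mn)))//.
  by rewrite lef_pV2 ?posrE// ler_nat ltnS.
- move=> x /= dgx; have [i _ Fix] : (\bigcup_i F i) x.
    by apply: contrapT => /gF g0; move: dgx; rewrite g0 leNgt d0.
  have /ltr_add_invr [k] : 0 < e i x by apply/e_gt0.
  (* [k] brings the threshold below [e i x], and [i.+1] puts the term [e i x] into the partial
     sum. *)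
  rewrite add0r => ke; exists (maxn k i.+1) => //=.
  apply: (@le_lt_trans _ _ k.+1%:R^-1).
    by rewrite lef_pV2 ?posrE// ler_nat ltnS leq_maxl.
  apply: (lt_le_trans ke); apply: (@le_trans _ _ (D i.+1 x)).
    by rewrite /D big_ord_recr/= lerDr sumr_ge0.
  by apply: ndD; exact: leq_maxr.
pose w := n.+1%:R^-1 : R.
have w0 : 0 < w by rewrite invr_gt0.
have m0 x : 0 < Num.max (D n x) w by rewrite lt_max w0 orbT.
(* Where [d <= g] the denominator is [D n], so the [h i] add up to the truncation of [g]; elsewhere
   the numerator vanishes and [w] keeps the quotient continuous. *)
pose h i x := Num.max (g x - d) 0 * e i x / Num.max (D n x) w.
have ch i : continuous (h i).
  apply: continuous_divr => [||x]; last by rewrite gt_eqF.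
    by apply: continuous_mulr => //; exact: continuous_truncate.
  by apply: continuous_maxr => //; exact: continuous_cst.
have -> : (fun x => Num.max (g x - d) 0) = (fun x => \sum_(i < n) h i x).
  apply/funext => x; rewrite /h -mulr_suml -mulr_sumr -/(D n x).
  have [gd|/nP/= wD] := ltP (g x) d.
    by rewrite max_r ?mul0r// subr_le0 ltW.
  by rewrite [Num.max (D n x) w]max_l ?mulfK// ?gt_eqF ?(lt_trans w0)// ltW.
rewrite functional_sum// (le_trans _ (Fr n))//; apply: ler_sum => i _.
apply: open_size_ub; split=> // x.
  apply/andP; split.
    by rewrite /h divr_ge0// ?(ltW (m0 _))// mulr_ge0// le_max lexx orbT.
  rewrite /h ler_pdivrMr// mul1r -[leRHS]mul1r ler_pM//.
  - by rewrite le_max lexx orbT.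
  - by rewrite ge_max ler01 andbT; have /andP[] := g01 x; lra.
  - rewrite le_max; apply/orP; left.
    by rewrite /D (bigD1 i)//= lerDl sumr_ge0.
move=> nFi; rewrite /h (_ : e i x = 0) ?mulr0 ?mul0r//.
by apply/le_anti; rewrite e_ge0 andbT leNgt; apply/negP => /e_gt0.
Qed.

Definition outer_size (A : set S) : R :=
  inf [set open_size U | U in [set U | open U /\ A `<=` U]].

Lemma outer_size_lb A U : open U -> A `<=` U -> outer_size A <= open_size U.
Proof.
move=> oU AU; apply: ge_inf; last by exists U.
by exists 0 => _ [V _ <-]; exact: open_size_ge0.
Qed.

Lemma outer_size_ge A r :
  (forall U, open U -> A `<=` U -> r <= open_size U) -> r <= outer_size A.
Proof.
move=> rA; apply: lb_le_inf; last by move=> _ [U [oU AU] <-]; exact: rA.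
by exists (open_size setT), setT => //; split; [exact: openT|].
Qed.

Lemma outer_size_ge0 A : 0 <= outer_size A.
Proof. by apply: outer_size_ge => U _ _; exact: open_size_ge0. Qed.

Lemma outer_size_open U : open U -> outer_size U = open_size U.
Proof.
move=> oU; apply/le_anti; rewrite outer_size_lb//=.
by apply: outer_size_ge => V _; exact: open_sizeS.
Qed.

Lemma outer_sizeS A B : A `<=` B -> outer_size A <= outer_size B.
Proof.
move=> AB; apply: outer_size_ge => U oU BU; apply: outer_size_lb => //.
exact: subset_trans BU.
Qed.

Lemma outer_size_sigma_subadditive (F : nat -> set S) :
  ((outer_size (\bigcup_i F i))%:E <= \sum_(i <oo) (outer_size (F i))%:E)%E.
Proof.
apply/lee_addgt0Pr => e e0.
(* The allowed excesses over all indices [i] add up to [e]. *)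
have eps i : exists U, [/\ open U, F i `<=` U &
    open_size U < outer_size (F i) + e / (2 ^ i.+1)%:R].
  have e0' : 0 < e / (2 ^ i.+1)%:R by rewrite divr_gt0// ltr0n expn_gt0.
  have hF : has_inf [set open_size U | U in [set U | open U /\ F i `<=` U]].
    split; first by exists (open_size setT), setT => //; split; [exact: openT|].
    by exists 0 => _ [V _ <-]; exact: open_size_ge0.
  by have [_ [U [oU FU] <-] Ue] := inf_adherent e0' hF; exists U; split.
have [U UP] := choice eps.
have oU i : open (U i) by case: (UP i).
apply: (@le_trans _ _ (\sum_(i <oo) ((outer_size (F i))%:E + (e / (2 ^
  i.+1)%:R)%:E))%E);
  last by apply: epsilon_trick; [move=> n;
    rewrite lee_fin outer_size_ge0|exact: ltW].
apply: (@le_trans _ _ (\sum_(i <oo) (open_size (U i))%:E)%E).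
  apply: le_trans (open_size_sigma_subadditive oU); rewrite lee_fin.
  apply: outer_size_lb; first exact: bigcup_open.
  by move=> x [i _ Fx]; exists i => //; have [_ FU _] := UP i; exact: FU.
apply: lee_nneseries => [i _ _|i _]; first by rewrite lee_fin open_size_ge0.
by have [_ _ /ltW] := UP i; rewrite -EFinD lee_fin.
Qed.

(** Take [g] subordinate to the intersection. It vanishes on the rest of [V], which thus lies in the
    open set [W] where [g < d]. If [h] is subordinate to [W], then [max (g - d) 0] and [h] are never
    both positive, so their sum is subordinate to [V]. *)
Lemma open_size_split U V : open U -> open V ->
  open_size (V `&` U) + outer_size (V `&` ~` U) <= open_size V.
Proof.
move=> oU oV; rewrite -lerBrDr; apply: open_size_le => g [cg g01 gVU].
rewrite lerBrDr; apply/ler_addgt0Pr => d d0.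
rewrite -lerBlDr addrAC -lerBrDl.
pose W := V `&` [set x | g x < d].
have oW : open W by apply: openI => //; exact: continuous_open_ltr.
apply: (le_trans (@outer_size_lb _ W _ _)) => //.
  by move=> x [Vx nUx]; split => //=; rewrite gVU// => -[].
apply: open_size_le => h [ch h01 hW]; rewrite lerBrDl.
apply: (le_trans (lerD (functional_truncate d cg) (lexx _))).
rewrite -LamD//; last exact: continuous_truncate.
apply: open_size_ub; split.
- by apply: continuous_addr => //; exact: continuous_truncate.
- move=> x; have /andP[g0 g1] := g01 x; have /andP[h0 h1] := h01 x.
  have [gd|dg] := ltP (g x) d.
    by rewrite max_r ?add0r ?h0// subr_le0 ltW.
  rewrite hW ?addr0; last by move=> [_ /=]; rewrite ltNge dg.
  by rewrite max_l ?subr_ge0// dg/= lerBlDr (le_trans g1)// lerDl ltW.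
- move=> x nVx; rewrite gVU; last by move=> [].
  by rewrite sub0r max_r ?oppr_le0 ?(ltW d0)// add0r hW// => -[].
Qed.

Lemma outer_size_caratheodory (m : {outer_measure set S -> \bar R}) :
  (forall A, m A = (outer_size A)%:E) ->
  forall U, open U -> m.-caratheodory U.
Proof.
move=> mE U oU; apply: le_caratheodory_measurable => A.
rewrite !mE -EFinD lee_fin; apply: outer_size_ge => V oV AV.
rewrite (le_trans _ (open_size_split oU oV))// lerD//.
  by apply: outer_size_lb; [exact: openI|exact: setSI].
by apply: outer_sizeS; exact: setSI.
Qed.

(** By Caratheodory's theorem [outer_size] is countably additive on a sigma-algebra that contains
    the open sets, hence the Borel sets. *)
Lemma borel_outer_measure : exists nu : borel_prob S R,
  forall U, open U -> nu U = (open_size U)%:E.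
Proof.
pose m0 (A : set S) := (outer_size A)%:E.
have m00 : m0 set0 = 0%E.
  by rewrite /m0 outer_size_open ?open_size0//; exact: open0.
have m0_ge0 A : (0 <= m0 A)%E by rewrite lee_fin outer_size_ge0.
have m0S : {homo m0 : A B / A `<=` B >-> (A <= B)%E}.
  by move=> A B AB; rewrite lee_fin outer_sizeS.
pose m : {outer_measure set S -> \bar R} := HB.pack m0
  (isOuterMeasure.Build R S m0 m00 m0_ge0 m0S outer_size_sigma_subadditive).
have mB (A : set (borel S)) : measurable A -> m.-caratheodory A.
  apply: smallest_sub; last by apply: outer_size_caratheodory.
  exact: (@sigma_algebra_measurable _ (caratheodory_type m)).
pose P0 (A : set (borel S)) := m0 A.
have P00 : P0 set0 = 0%E by [].
have P0_ge0 A : (0 <= P0 A)%E by [].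
have P0s : semi_sigma_additive P0.
  move=> F mF tF mUF; apply: (@caratheodory_measure_sigma_additive R S m) => //.
    by move=> i; exact: mB.
  exact: mB.
have P01 : P0 setT = 1%E by rewrite /P0/m0 outer_size_open ?open_sizeT//;
  exact: openT.
have [P PE] := probability_of_set_function P00 P0_ge0 P0s P01.
by exists P => U oU; rewrite PE /P0/m0 outer_size_open.
Qed.

(** Divided by [h], the slice of [f] between the levels [a] and [a + h] takes values in [0, 1] and
    vanishes where [f <= a]. *)
Lemma functional_slice (f : S -> R) (a h : R) : continuous f -> 0 < h ->
  Lam (fun x => Num.min (f x) (a + h)) - Lam (fun x => Num.min (f x) a) <=
  h * open_size [set x | a < f x].
Proof.
move=> cf h0.
have cmin b : continuous (fun x => Num.min (f x) b).
  by apply: continuous_minr => //; exact: continuous_cst.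
rewrite -functionalB// mulrC -ler_pdivrMr// mulrC -LamZ;
  last exact: continuous_subr.
apply: open_size_ub; split.
- by apply: continuous_scaler; exact: continuous_subr.
- move=> x; rewrite ler_pdivlMl// mulr0 ler_pdivrMl// mulr1.
  by rewrite !minElt; do 2 case: ltP => ?; apply/andP; split; lra.
- move=> x /negP; rewrite -leNgt => fa.
  by rewrite !min_l ?subrr ?mulr0// (le_trans fa)// lerDl ltW.
Qed.

End riesz_outer_measure.

Lemma continuous_integrable (R : realType) (S : ptopologicalType)
    (P : borel_prob S R) (f : S -> R) : compact [set: S] -> continuous f ->
  P.-integrable [set: borel S] (EFin \o (f : borel S -> R)).
Proof.
move=> cS cf; apply: measurable_bounded_integrable => //.
- exact: (le_lt_trans (probability_le1 P measurableT) (ltry _)).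
- exact: continuous_borel_measurable.
- have [B [_ fB]] := compact_bounded_continuous cS cf.
  by exists B; split; [exact: num_real|move=> r Br x _;
    exact: le_trans (ltW Br)].
Qed.

Lemma Rintegral_probability_cst d (T : measurableType d) (R : realType)
    (P : probability T R) (r : R) : \int[P]_x r = r.
Proof.
rewrite Rintegral_cst// -[RHS]mulr1; congr (_ * _).
exact: (congr1 fine (@probability_setT _ _ _ P)).
Qed.

(** A function with values in [0, 1] is cut into slices of height [h]. [Lam] of a slice is at most
    [h] times the measure of a superlevel set, hence at most the integral of the slice just below
    it; the shift by one slice costs [h]. *)
Theorem riesz_markov_probability (R : realType) (S : ptopologicalType)
    (Lam : (S -> R) -> R) :
  compact [set: S] ->
  (forall U : set S, open U -> exists d : S -> R,
    [/\ continuous d, forall x, 0 <= d x & forall x, 0 < d x <-> U x]) ->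
  (forall f g : S -> R, continuous f -> continuous g ->
    Lam (fun x => f x + g x) = Lam f + Lam g) ->
  (forall (k : R) (f : S -> R), continuous f ->
    Lam (fun x => k * f x) = k * Lam f) ->
  (forall f : S -> R, continuous f -> (forall x, 0 <= f x) -> 0 <= Lam f) ->
  Lam (fun=> 1) = 1 ->
  exists nu : borel_prob S R, forall f : S -> R, continuous f ->
    \int[nu]_x f x = Lam f.
Proof.
move=> cS czS LamD LamZ Lam_ge0 Lam1.
have [nu nuE] := borel_outer_measure cS czS LamD LamZ Lam_ge0 Lam1.
exists nu.
have Rint (f : S -> R) : continuous f ->
    nu.-integrable [set: borel S] (EFin \o (f : borel S -> R)).
  exact: continuous_integrable.
have le01 (f : S -> R) : continuous f -> (forall x, 0 <= f x <= 1) ->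
    Lam f <= \int[nu]_x f x.
  move=> cf f01; apply/ler_addgt0Pr => e e0.
  have /ltr_add_invr [n] := e0; rewrite add0r; set h := n.+1%:R^-1 => he.
  have h0 : 0 < h by rewrite invr_gt0.
  have cmin b : continuous (fun x => Num.min (f x) b).
    by apply: continuous_minr => //; exact: continuous_cst.
  pose A a := Lam (fun x => Num.min (f x) a).
  pose B a := \int[nu]_x Num.min (f x) a.
  (* Where [a < f], the slice between [a - h] and [a] has its full height [h]. *)
  have slice a : h * open_size Lam [set x | a < f x] <= B a - B (a - h).
    have oU : open [set x | a < f x] by exact: continuous_open_gtr.
    have mU : measurable ([set x | a < f x] : set (borel S)) by exact:
      sub_sigma_algebra.
    rewrite /B -RintegralB//; [|exact: (Rint _ (cmin _))|exact: (Rint _ (cmin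
      _))].
    have iU : nu.-integrable [set: borel S] (EFin \o (\1_[set x | a < f x] :
      borel S -> R)).
      by apply: integrable_indic => //; rewrite ?nuE ?ltry.
    have -> : h * open_size Lam [set x | a < f x] =
        \int[nu]_x (h * \1_[set x | a < f x] x).
      rewrite RintegralZl// /Rintegral integral_indic// setIT; congr (_ * _).
      exact: (esym (congr1 fine (nuE _ oU))).
    apply: le_Rintegral => //.
    - exact: (integrableZl measurableT h iU).
    - by apply: (Rint (fun x => _ - _)); exact: continuous_subr.
    - move=> x _; rewrite indicE; case: (boolP (x \in _)) => [/set_mem/= ax|_].
        by rewrite mulr1 !min_r ?(ltW ax)//; lra.
      by rewrite mulr0 subr_ge0 le_min ge_min lexx/= ge_min; apply/orP; right;
        lra.
  have AB k : A (h * k.+1%:R) <= B (h * k%:R) + h.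
    elim: k => [|k ih].
      rewrite mulr0 mulr1.
      have -> : B 0 = 0.
        rewrite /B -[RHS](Rintegral_probability_cst nu).
        by apply: eq_Rintegral => x _; rewrite min_r//; case/andP: (f01 x).
      rewrite add0r -[leRHS](functional_cst LamZ Lam1);
        apply: (le_functional LamD LamZ Lam_ge0) => //.
        exact: continuous_cst.
      by move=> x; rewrite ge_min lexx orbT.
    have := functional_slice LamD LamZ Lam_ge0 Lam1 (h * k.+1%:R) cf h0.
    have := slice (h * k.+1%:R).
    rewrite -/(A (h * k.+1%:R)) (_ : h * k.+1%:R + h = h * k.+2%:R);
      last by rewrite -[k.+2%:R]natr1; ring.
    rewrite -/(A (h * k.+2%:R)) (_ : h * k.+1%:R - h = h * k%:R);
      last by rewrite -natr1; ring.
    by move: ih; lra.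
  (* Since [h * (n+1) = 1], the two truncations are now at the levels [1 + h] and 1, where both
     leave [f] unchanged. *)
  have := AB n.+1.
  have hn : h * n.+1%:R = 1 by rewrite /h mulVf.
  rewrite -[n.+2%:R]natr1 mulrDr hn mulr1 /A /B.
  have -> : (fun x => Num.min (f x) (1 + h)) = f.
    apply/funext => x; rewrite min_l//; have /andP[_] := f01 x; move: h0; lra.
  have -> : (fun x => Num.min (f x) 1) = f.
    by apply/funext => x; rewrite min_l//; have /andP[] := f01 x.
  by move: he; lra.
have eq01 (f : S -> R) : continuous f -> (forall x, 0 <= f x <= 1) ->
    \int[nu]_x f x = Lam f.
  move=> cf f01; apply/le_anti; rewrite le01// andbT.
  (* The reverse inequality is the one for [1 - f]. *)
  have := le01 (fun x => 1 - f x); rewrite RintegralB//; last 2 first.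
  - by apply: (Rint (fun=> 1)); exact: continuous_cst.
  - exact: Rint.
  rewrite Rintegral_probability_cst functionalB//; last exact: continuous_cst.
  rewrite Lam1 lerD2l lerN2; apply.
    by apply: continuous_subr => //; exact: continuous_cst.
  by move=> x; have /andP[f0 f1] := f01 x; rewrite subr_ge0 f1/= gerBl.
move=> f cf; have [B [B0 fB]] := compact_bounded_continuous cS cf.
(* An affine change brings the bounded [f] into [0, 1]. *)
pose g x := (f x + B) / (2 * B).
have B20 : 0 < 2 * B by rewrite mulr_gt0.
have fE x : f x = 2 * B * g x - B by rewrite /g mulrC divfK ?gt_eqF// addrK.
have cg : continuous g.
  apply: continuous_mulr; last exact: continuous_cst.
  by apply: continuous_addr => //; exact: continuous_cst.
have cBg : continuous (fun x => 2 * B * g x) by exact: continuous_scaler.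
transitivity (\int[nu]_x (2 * B * g x - B)); first by apply: eq_Rintegral =>
  x _.
rewrite RintegralB//; last 2 first.
- exact: (Rint _ cBg).
- by apply: (Rint (fun=> B)); exact: continuous_cst.
rewrite RintegralZl//; last exact: Rint.
rewrite Rintegral_probability_cst eq01//; last first.
  move=> x; have := fB x; rewrite ler_norml => /andP[? ?].
  rewrite ler_pdivlMr// mul0r ler_pdivrMr// mul1r; apply/andP; split; lra.
rewrite -LamZ// -[X in _ - X](functional_cst LamZ Lam1) -functionalB//;
  last exact: continuous_cst.
by congr Lam; apply/funext => x; rewrite -fE.
Qed.

(** * Measurable selection *)

Lemma measurable_sublevel (R : realType) d (S : measurableType d) (g : S -> R)
    (r : R) : measurable_fun setT g -> measurable [set s | g s < r].
Proof.
move=> mg; rewrite -[X in measurable X]setTI (_ : mkset _ = g @^-1` `]-oo, r[).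
  exact: mg.
by apply/seteqP; split => s; rewrite /= in_itv.
Qed.

Section lexicographic_selection.
Variables (R : realType) (d : measure_display) (S : measurableType d).
Variables (X : ptopologicalType) (x : nat -> X).
Hypothesis cptX : compact [set: X].
Hypothesis dense_x : forall U, open U -> U !=set0 -> exists n, U (x n).

Definition caratheodory_fun (f : S -> X -> R) :=
  (forall u, measurable_fun setT (f ^~ u)) /\ forall s, continuous (f s).

Lemma compact_attained_min (f g : X -> R) : continuous f -> continuous g ->
  (exists u, g u = 0) ->
  exists u, g u = 0 /\ forall v, g v = 0 -> f u <= f v.
Proof.
move=> cf cg g0.
have cZ : compact [set u | g u = 0].
  apply: (subclosed_compact _ cptX) => //.
  rewrite (_ : mkset _ = g @^-1` [set 0])//.
  by move/continuous_closedP : cg; apply; exact: closed_eq.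
have [|c /set_mem cZ0 cmin] := compact_EVT_min g0 cZ (f := f).
  by apply: continuous_subspaceT.
by exists c; split=> // v v0; apply: cmin; exact/mem_set.
Qed.

(** The sublevel set of [p] at [r] is described through the dense sequence only: for each [k] some
    [x m] has [Q < 1/(k+1)] and [f < r + 1/(k+1)]. A minimiser is approximated by density;
    conversely, if [r < p s], compactness yields a [k] at which no point passes both tests. *)
Lemma measurable_constrained_min (Q f : S -> X -> R) (p : S -> R) :
  caratheodory_fun Q -> caratheodory_fun f ->
  (forall s, exists u, Q s u = 0 /\ f s u = p s) ->
  (forall s u, Q s u = 0 -> p s <= f s u) ->
  (forall s u, 0 <= Q s u) ->
  measurable_fun setT p.
Proof.
move=> [mQ cQ] [mf cf] pe pmin Q0.
apply: (measurability _ (RGenOInfty.measurableE R)) => _ [_ [r ->] <-].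
rewrite setTI -[X in measurable X]setCK; apply: measurableC.
pose e k : R := k.+1%:R^-1.
have e0 k : 0 < e k by rewrite invr_gt0.
have -> : ~` (p @^-1` `]r, +oo[) = \bigcap_k \bigcup_m
    ([set s | Q s (x m) < e k] `&` [set s | f s (x m) < r + e k]).
  apply/seteqP; split => [s /= /negP|s /= sr].
    rewrite in_itv/= andbT -leNgt => psr k _.
    have [u [Qu fu]] := pe s.
    have [] := dense_x (openI (continuous_open_ltr (e k) (cQ s))
      (continuous_open_ltr (r + e k) (cf s))).
      by exists u; split; rewrite /= ?Qu ?fu// (le_lt_trans psr)// ltrDl.
    by move=> m [? ?]; exists m.
  apply/negP; rewrite in_itv/= andbT -leNgt leNgt; apply/negP => rps.
  have [|||k kV] := @compact_increasing_cover X setT (fun k =>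
      [set u | e k < Q s u] `|` [set u | r + e k < f s u]) cptX.
  - by move=> k; apply: openU; exact: continuous_open_gtr.
  - move=> m n mn u; have ee : e n <= e m by rewrite lef_pV2 ?posrE// ler_nat
    ltnS.
    move=> [|] /= eu; [left|right]; apply: le_lt_trans eu => //.
    by rewrite lerD2l.
  - move=> u _; have [Qu0|Qu0] := eqVneq (Q s u) 0.
      have /ltr_add_invr[k] := lt_le_trans rps (pmin _ _ Qu0).
      by exists k => //; right.
    have : 0 < Q s u by rewrite lt_neqAle eq_sym Qu0 Q0.
    by move=> /ltr_add_invr[k]; rewrite add0r; exists k => //; left.
  have [m _ [/= Qk fk]] := sr k I.
  have [/=|/=] := kV (x m) I; first by rewrite ltNge (ltW Qk).
  by rewrite ltNge (ltW fk).
apply: bigcapT_measurable => k; apply: bigcupT_measurable => m.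
by apply: measurableI; exact: measurable_sublevel.
Qed.

Definition constrained_min (Q f : S -> X -> R) (s : S) : R :=
  inf [set f s u | u in [set u | Q s u = 0]].

Lemma constrained_minP (Q f : S -> X -> R) (s : S) : continuous (Q s) ->
  continuous (f s) -> (exists u, Q s u = 0) ->
  (exists u, Q s u = 0 /\ f s u = constrained_min Q f s) /\
  forall u, Q s u = 0 -> constrained_min Q f s <= f s u.
Proof.
move=> cQ cf Q0; have [u [Qu umin]] := compact_attained_min cf cQ Q0.
suff -> : constrained_min Q f s = f s u by split=> //; exists u.
apply/le_anti/andP; split; last first.
  by apply: lb_le_inf => [|_ [v Qv <-]]; [exists (f s u), u|exact: umin].
by apply: ge_inf; [exists (f s u) => _ [v Qv <-]; exact: umin|exists u].
Qed.

(** Its zeros are the points that minimise the first [k] functions lexicographically. Encoding this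
    set by a nonnegative Caratheodory function keeps its dependence on [s] measurable. *)
Fixpoint lex_constraint (f : nat -> S -> X -> R) (k : nat) : S -> X -> R :=
  if k is k'.+1 then fun s u => lex_constraint f k' s u +
    `|f k' s u - constrained_min (lex_constraint f k') (f k') s|
  else fun=> fun=> 0.

(** The zero sets of the successive constraints are nonempty, compact and decreasing, so they share
    a point [sigma s]. Its values [f k s (sigma s)] are the constrained minima, which are measurable
    in [s]. *)
Lemma lexicographic_minimizer (f : nat -> S -> X -> R) :
  (forall k, caratheodory_fun (f k)) ->
  exists sigma : S -> X, forall k,
    measurable_fun setT (fun s => f k s (sigma s)) /\
    forall s u, (forall i, (i < k)%N -> f i s u = f i s (sigma s)) ->
      f k s (sigma s) <= f k s u.
Proof.
move=> cf; pose Q := lex_constraint f; pose p k := constrained_min (Q k) (f k).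
have Q_ge0 k s u : 0 <= Q k s u.
  by elim: k => //= k ih; rewrite addr_ge0.
have H k : caratheodory_fun (Q k) /\ forall s, exists u, Q k s u = 0.
  elim: k => [|k [[mQ cQ] Q0]].
    split; last by move=> s; exists point.
    by split=> [u|s]; [exact: measurable_cst|exact: continuous_cst].
  have [mf cfk] := cf k.
  have mp : measurable_fun setT (p k).
    apply: (@measurable_constrained_min (Q k) (f k)) => // s.
      exact: (constrained_minP (cQ s) (cfk s) (Q0 s)).1.
    exact: (constrained_minP (cQ s) (cfk s) (Q0 s)).2.
  split; last first.
    move=> s; have [u [Qu fu]] := (constrained_minP (cQ s) (cfk s) (Q0 s)).1.
    by exists u; rewrite /Q/= -/(Q k) Qu fu subrr normr0 addr0.
  split => [u|s].
    apply: measurable_funD; first exact: mQ.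
    by apply: measurableT_comp => //; apply: measurable_funB => //; exact: mf.
  move=> u; apply: cvgD; first exact: cQ.
  by apply: cvg_norm; apply: cvgB; [exact: cfk|exact: cvg_cst].
have cQ k s : continuous (Q k s) by have [[_]] := H k.
have Q0 k s : exists u, Q k s u = 0 by have [_] := H k.
have ndQ s u : {homo Q ^~ s ^~ u : m n / (m <= n)%N >-> m <= n}.
  by apply/nondecreasing_seqP => n; rewrite /Q/= lerDl.
have allQ s : exists u, forall k, Q k s u = 0.
  apply: contrapT => /forallNP nQ.
  have [|||k kV] := @compact_increasing_cover X setT (fun k =>
    [set u | 0 < Q k s u]) cptX.
  - by move=> k; exact: continuous_open_gtr.
  - by move=> m n mn u /= /lt_le_trans; apply; exact: ndQ.
  - move=> u _; have /existsNP[k Qk] := nQ u.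
    by exists k => //=; rewrite lt_neqAle Q_ge0 andbT eq_sym; exact/eqP.
  by have [u Qu] := Q0 k s; have /= := kV u I; rewrite Qu ltxx.
have [sigma sP] := choice allQ.
have fE k s : f k s (sigma s) = p k s.
  have := sP s k.+1; rewrite /Q/= -/(Q k) sP add0r => /eqP.
  by rewrite normr_eq0 subr_eq0 => /eqP.
exists sigma => k; split.
  under eq_fun do rewrite fE.
  apply: (@measurable_constrained_min (Q k) (f k)) => //.
  - by have [] := H k.
  - move=> s; exact: (constrained_minP (cQ k s) ((cf k).2 s) (Q0 k s)).1.
  - move=> s; exact: (constrained_minP (cQ k s) ((cf k).2 s) (Q0 k s)).2.
move=> s u fu; rewrite fE.
apply: (constrained_minP (cQ k s) ((cf k).2 s) (Q0 k s)).2.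
elim: k fu => // k ih fu; rewrite /Q/= -/(Q k) ih ?add0r; last first.
  by move=> i ik; apply: fu; rewrite (ltn_trans ik).
by rewrite fu// -/(p k s) fE subrr normr0.
Qed.

(** The cozero functions [e n] of a basis are appended to [f0] and [f1] in the lexicographic order.
    Measurability of every [e n (sigma s)] makes the preimages of basic open sets measurable, hence
    [sigma] itself. *)
Lemma measurable_argmin_selection (B : nat -> set X) (e : nat -> X -> R)
    (f0 f1 : S -> X -> R) :
  open_basis B -> (forall n, continuous (e n)) ->
  (forall n u, 0 < e n u <-> B n u) ->
  caratheodory_fun f0 -> caratheodory_fun f1 ->
  exists sigma : S -> X, [/\
    measurable_fun setT (sigma : S -> borel X),
    measurable_fun setT (fun s => f0 s (sigma s)),
    measurable_fun setT (fun s => f1 s (sigma s)),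
    forall s u, f0 s (sigma s) <= f0 s u &
    forall s u, f0 s u = f0 s (sigma s) -> f1 s (sigma s) <= f1 s u].
Proof.
move=> [oB bB] ce eB cf0 cf1.
pose f k : S -> X -> R := match k with 0%N => f0 | 1%N => f1 | n.+2 => fun=>
  e n end.
have cf k : caratheodory_fun (f k).
  by move: k => [//|[//|n]]; split=> [u|s]; [exact: measurable_cst|exact: ce].
have [sigma sP] := lexicographic_minimizer cf; exists sigma; split.
- apply: (@measurability _ _ S (borel X) setT sigma (@open X)) =>
  // _ [A oA <-].
  pose C n := if `[< B n `<=` A >] then sigma @^-1` B n else set0.
  rewrite setTI (_ : _ @^-1` _ = \bigcup_n C n).
    apply: bigcupT_measurable => n; rewrite /C; case: asboolP => _;
      last exact: measurable0.
    rewrite (_ : _ @^-1` _ = setT `&` (fun s => e n (sigma s)) @^-1` `]0, +oo[).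
      by have [mf _] := sP n.+2; exact: mf.
    by apply/seteqP; split=> s /=; rewrite in_itv/= andbT; [move=> /eB|move=>
      [_ /eB]].
  apply/seteqP; split => [s As|s [n _]]; last first.
    by rewrite /C; case: asboolP => // + Bs; apply.
  have [n [Bn BA]] := bB _ _ oA As; exists n => //.
  by rewrite /C; case: asboolP.
- by have [] := sP 0%N.
- by have [] := sP 1%N.
- by move=> s u; have [_] := sP 0%N; apply.
- by move=> s u us; have [_] := sP 1%N; apply => -[].
Qed.

End lexicographic_selection.

(** * Kernels and mixtures *)

Lemma integral_probability_cst d (T : measurableType d) (R : realType)
    (P : probability T R) (r : \bar R) : (\int[P]_x r)%E = r.
Proof.
rewrite integral_cst// -[RHS]mule1; congr (_ * _)%E.
exact: (@probability_setT _ _ _ P).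
Qed.

Lemma pushforward_probability d1 d2 (T1 : measurableType d1)
    (T2 : measurableType d2) (R : realType) (m : {measure set T1 -> \bar R})
    (f : T1 -> T2) : measurable_fun setT f -> m setT = 1%E ->
  exists P : probability T2 R, forall A, P A = m (f @^-1` A).
Proof.
move=> mf m1; apply: (@probability_of_set_function _ _ _ (pushforward m f)).
- exact: measure0.
- by move=> A; exact: measure_ge0.
- exact: measure_semi_sigma_additive.
- by [].
Qed.

Section kernel_mixture.
Local Open Scope ereal_scope.
Variables (R : realType) (d1 d2 : measure_display).
Variables (T : measurableType d1) (S : measurableType d2).
Variable Q : T -> probability S R.
Hypothesis mQ : forall A, measurable A -> measurable_fun setT (fun u => Q u A).

Let Q' u : giry S R := Q u.

Let mQ' : measurable_fun setT Q'.
Proof. exact: measurable_giry_codensity. Qed.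

(** On measurable sets [nu] is the bind of [m] and [Q] in the Giry monad. *)
Lemma mixture_integral (m : probability T R) (nu : probability S R)
    (f : S -> \bar R) :
  (forall A, measurable A -> nu A = \int[m]_u Q u A) ->
  measurable_fun setT f -> (forall s, 0 <= f s) ->
  \int[nu]_s f s = \int[m]_u \int[Q u]_s f s.
Proof.
move=> nuE mf f0.
have -> : \int[nu]_s f s = giry_int (giry_bind (m : giry T R) mQ') f.
  apply: eq_measure_integral => A mA _.
  rewrite /giry_bind/= giry_int_map//; last exact: measurable_giry_ev.
  exact: nuE.
by rewrite giry_int_bind.
Qed.

End kernel_mixture.

Section section_kernel.
Variables (R : realType) (X Y : ptopologicalType).
Variable kap : R.-pker (borel X) ~> (borel Y).

Lemma xsection_preimage (A : set (X * Y)) (u : X) :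
  xsection A u = (fun v => (u, v)) @^-1` A.
Proof. by apply/seteqP; split => v /xsectionP. Qed.

Lemma continuous_section (u : X) : continuous (fun v : Y => (u, v)).
Proof. by move=> v; apply: cvg_pair => //=; exact: cvg_cst. Qed.

Lemma measurable_section (u : X) :
  measurable_fun setT ((fun v => (u, v)) : borel Y -> borel (X * Y)%type).
Proof. exact: (@continuous_borel_borel Y (X * Y)%type _ (@continuous_section
  u)). Qed.

(** [Q u] is the image of [kap u] under the embedding of [Y] as the fibre over [u]. *)
Lemma section_kernel : exists Q : X -> borel_prob (X * Y)%type R,
  forall u A, Q u A = kap u (xsection A u).
Proof.
suff /choice[Q QP] : forall u, exists P : borel_prob (X * Y)%type R,
    forall A, P A = kap u (xsection A u) by exists Q.
move=> u.
have [P PE] := @pushforward_probability _ _ (borel Y) (borel (X * Y)%type) R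
  (kap u) _ (measurable_section u) (prob_kernel u).
by exists P => A; rewrite PE xsection_preimage.
Qed.

End section_kernel.

(** * Weak* limits and continuity of the section kernel *)

Lemma weak_star_closed_cvg (R : realType) (S : ptopologicalType)
    (K : set (borel_prob S R)) (I : Type) (F : set_system I)
    (q : I -> borel_prob S R) (nu : borel_prob S R) :
  ProperFilter F -> weak_star_closed K -> (forall i, K (q i)) ->
  (forall f : S -> R, continuous f ->
    (fun i => \int[q i]_s f s) @ F --> \int[nu]_s f s) ->
  K nu.
Proof.
move=> FF cK Kq qnu; apply: cK => A [_ [[W oW <-] Wnu WA]].
(* The weak* topology is pulled back along [integral_eval] from pointwise convergence, so one test
   function at a time suffices. *)
have : (fun i => @integral_eval R S (q i)) @ F --> integral_eval nu.
  apply/cvg_sup => f N [_ [[V oV <-] Vf VN]].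
  have := qnu f (@cts_fun _ _ f) V (open_nbhs_nbhs (conj oV Vf)).
  by apply: (@filterS _ F) => i Vi; exact: VN.
move=> /(_ W) /= FW.
have [i Wi] : exists i, W (integral_eval (q i)).
  by apply: (@filter_ex _ F); apply: FW; exact: open_nbhs_nbhs.
by exists (q i); split; [exact: Kq|exact: WA].
Qed.

(** Compactness of the segment gives a cluster point, and a cluster point of an ultrafilter is a
    limit. *)
Lemma ultrafilter_bounded_cvg (R : realType) (I : Type) (U : set_system I)
    (phi : I -> R) (B : R) : UltraFilter U -> (forall i, `|phi i| <= B) ->
  cvg (phi @ U).
Proof.
move=> UU phiB.
have cB : compact `[- B, B] by exact: segment_compact.
have [|p [_ clp]] := cB (phi @ U) _.
  by apply: (@filterE I U) => i /=; rewrite in_itv/= -ler_norml.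
apply/cvg_ex; exists p => N Np /=.
have [//|nN] := in_ultra_setVsetC (phi @^-1` N) UU.
have : (phi @ U) (~` N) by [].
by move=> /clp/(_ Np) [z []].
Qed.

Lemma polish_cozero (R : realType) (T : ptopologicalType) (U : set T) :
  polish R T -> open U -> exists d : T -> R,
    [/\ continuous d, forall x, 0 <= d x & forall x, 0 < d x <-> U x].
Proof. by move=> [_ [M [_ hM]]] oU; exact: (open_cozero hM). Qed.

Lemma polish_distance (R : realType) (T : ptopologicalType) (x0 : T) :
  polish R T -> exists h : T -> R,
    [/\ continuous h, forall x, 0 <= h x & forall x, h x = 0 <-> x = x0].
Proof.
move=> [_ [M [_ [f [g [fK gK cf cg]]]]]].
exists (fun x => mdist (g x) (g x0)); split => [x|x|x]; last 2 first.
- exact: mdist_ge0.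
- split=> [/mdist_positivity/(congr1 f)|->]; last exact: mdistxx.
  by rewrite !gK.
apply/cvgrPdist_lt => e e0.
have /cg : nbhs (g x) (ball (g x) e) by exact: nbhsx_ballx.
apply: (@filterS _ (nbhs x)) => y; rewrite /= ballEmdist/= => xy.
have := metric_triangle (g x) (g y) (g x0); have :=
  metric_triangle (g y) (g x) (g x0).
rewrite (metric_sym (g y) (g x)) ltr_norml => ? ?; apply/andP; split; lra.
Qed.

Lemma le_Rintegral_continuous (R : realType) (S : ptopologicalType)
    (P : borel_prob S R) (f g : S -> R) : compact [set: S] ->
  continuous f -> continuous g -> (forall x, f x <= g x) ->
  \int[P]_x f x <= \int[P]_x g x.
Proof. by move=> cS cf cg fg; apply: le_Rintegral => //;
  exact: continuous_integrable. Qed.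

Lemma Rintegral_continuous_bound (R : realType) (S : ptopologicalType)
    (P : borel_prob S R) (f : S -> R) (B : R) : compact [set: S] ->
  continuous f -> (forall x, `|f x| <= B) -> `|\int[P]_x f x| <= B.
Proof.
move=> cS cf fB; rewrite ler_norml; apply/andP; split.
  rewrite -[leLHS](Rintegral_probability_cst P).
  apply: le_Rintegral_continuous => //; first exact: continuous_cst.
  by move=> x; have := fB x; rewrite ler_norml => /andP[].
rewrite -[leRHS](Rintegral_probability_cst P).
apply: le_Rintegral_continuous => //; first exact: continuous_cst.
by move=> x; have := fB x; rewrite ler_norml => /andP[].
Qed.

Lemma EFin_Rintegral_continuous (R : realType) (S : ptopologicalType)
    (P : borel_prob S R) (f : S -> R) : compact [set: S] -> continuous f ->
  (\int[P]_x (f x)%:E)%E = (\int[P]_x f x)%:E.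
Proof.
move=> cS cf; rewrite /Rintegral fineK//.
by apply: (@integrable_fin_num _ _ _ P);
  [exact: measurableT|exact: continuous_integrable].
Qed.

Section feller.
Variables (R : realType) (X Y : ptopologicalType).
Variable kap : R.-pker (borel X) ~> (borel Y).
Variable Q : X -> borel_prob (X * Y)%type R.
Hypotheses (hX : polish R X) (hY : polish R Y) (hS : polish R (X * Y)%type).
Hypothesis cptS : compact [set: X * Y].
Hypothesis QE : forall u A, Q u A = kap u (xsection A u).

(** [A] also belongs to the product sigma-algebra, where measurability of
    [u |-> kap u (xsection A u)] is a property of kernels. *)
Lemma measurable_section_kernel (A : set (borel (X * Y)%type)) :
  measurable A -> measurable_fun [set: borel X] (fun u => Q u A).
Proof.
move=> mA; have [B bB] := polish_basis hX; have [C bC] := polish_basis hY.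
rewrite (_ : (fun u => Q u A) = (fun u => kap u (xsection A u))); last first.
  by apply/funext => u; rewrite QE.
apply: measurable_fun_xsection_finite_kernel.
by rewrite inE; exact: (borel_prod_measurable bB bC).
Qed.

Lemma section_kernel_product (u : X) (s : X * Y) : K_of kap s (Q u).
Proof.
exists (\d_(u : borel X) : borel_prob X R) => A mA.
rewrite integral_dirac//; last first.
  rewrite (_ : (fun w => kap w _) = (fun w => Q w A)); last first.
    by apply/funext => w; rewrite QE.
  exact: measurable_section_kernel.
by rewrite diracT mul1e QE.
Qed.

Lemma section_kernel_integral (u : X) (f : X * Y -> \bar R) :
  measurable_fun [set: borel (X * Y)%type] f -> (forall s, (0 <= f s)%E) ->
  (\int[Q u]_s f s = \int[kap u]_v f (u, v))%E.
Proof.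
move=> mf f0; transitivity (\int[pushforward (kap u)
    ((fun v => (u, v)) : borel Y -> borel (X * Y)%type)]_s f s)%E.
  apply: eq_measure_integral => [|msec A mA _]; first exact: measurable_section.
  exact: (etrans (QE u A) (congr1 (kap u) (xsection_preimage A u))).
rewrite (@ge0_integral_pushforward _ _ (borel Y) (borel (X * Y)%type))//.
exact: measurable_section.
Qed.

Lemma section_kernel_feller (s0 : X * Y) (f : X * Y -> R) :
  weak_star_closed (K_of kap s0) -> continuous f ->
  continuous (fun u => \int[Q u]_s f s).
Proof.
move=> cK cf u0; apply/cvgrPdist_lt => e e0; apply: contrapT => nF.
pose F u := \int[Q u]_s f s.
pose E := [set u | e <= `|F u0 - F u|].
(* Discontinuity at [u0] means that [E] meets every neighbourhood of [u0]. *)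
have pW : ProperFilter (within E (nbhs u0)).
  apply: Build_ProperFilter_ex => A; rewrite /within/= => EA.
  apply: contrapT => /forallNP nA; apply: nF.
  apply: (@filterS _ (nbhs u0)) EA => u EA; rewrite ltNge; apply/negP => Eu.
  exact: (nA u (EA Eu)).
have [U [UU WU]] := ultraFilterLemma pW.
have UE : U E by apply: WU; rewrite /within/=; near=> u.
have Uu0 : U --> u0 by move=> A Au0; apply: WU;
  apply: (@filterS _ (nbhs u0)) Au0 => u.
(* Along the ultrafilter all these bounded integrals converge, which defines a positive normalised
   functional on C(S). *)
pose L (g : X * Y -> R) : R := lim ((fun u => \int[Q u]_s g s) @ U).
have cvgL (g : X * Y -> R) : continuous g -> (fun u => \int[Q u]_s g s) @ U -->
  L g.
  move=> cg; have [B [_ gB]] := compact_bounded_continuous cptS cg.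
  apply: (ultrafilter_bounded_cvg (B := B)) => u.
  exact: Rintegral_continuous_bound.
have Qint (g : X * Y -> R) u : continuous g ->
  (Q u).-integrable setT (EFin \o (g : borel (X * Y)%type -> R)).
  by move=> cg; exact: continuous_integrable.
have limL (g : X * Y -> R) (l : R) : (fun u => \int[Q u]_s g s) @ U --> l ->
  L g = l.
  by move=> gl; apply/cvg_lim => //; exact: Rhausdorff.
have LD (g h : X * Y -> R) : continuous g -> continuous h -> L (fun x =>
  g x + h x) = L g + L h.
  move=> cg ch; apply: limL.
  rewrite (_ : (fun u => _) = (fun u => \int[Q u]_s g s + \int[Q u]_s h s)).
    by apply: cvgD; exact: cvgL.
  by apply/funext => u; rewrite RintegralD//; exact: Qint.
have LZ (k : R) (g : X * Y -> R) : continuous g -> L (fun x =>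
  k * g x) = k * L g.
  move=> cg; apply: limL.
  rewrite (_ : (fun u => _) = (fun u => k * \int[Q u]_s g s)).
    by apply: cvgM; [exact: cvg_cst|exact: cvgL].
  by apply/funext => u; rewrite RintegralZl//; exact: Qint.
have L0 (g : X * Y -> R) : continuous g -> (forall x, 0 <= g x) -> 0 <= L g.
  move=> cg g0; apply: limr_ge; first by apply: cvgP; exact: cvgL cg.
  by apply: nearW => u; exact: Rintegral_ge0.
have L1 : L (fun=> 1) = 1.
  apply: limL; rewrite (_ : (fun u => _) = fun=> 1); first exact: cvg_cst.
  by apply/funext => u; exact: Rintegral_probability_cst.
have [nu nuE] := riesz_markov_probability cptS (fun U =>
  @polish_cozero _ _ U hS) LD LZ L0 L1.
have [m mnu] : K_of kap s0 nu.
  apply: (weak_star_closed_cvg (F := U) (q := Q)) => //.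
    by move=> u; exact: section_kernel_product.
  by move=> g cg; rewrite nuE//; exact: cvgL.
have nuQ A : measurable A -> nu A = (\int[m]_u Q u A)%E.
  by move=> mA; rewrite mnu//; apply: eq_integral => u _; rewrite QE.
have [h [ch h0 hu0]] := polish_distance u0 hX.
(* The integral of [g] under [Q u] is its value over [u], which tends to 0 along [U]. So the first
   marginal [m] of the limit [nu] is carried by [u0]. *)
pose g (s : X * Y) := Num.min (h s.1) 1.
have cg : continuous g.
  apply: continuous_minr; last exact: continuous_cst.
  by move=> s; apply: continuous_comp; [exact: cvg_fst|exact: ch].
have ch1 : continuous (fun u => Num.min (h u) 1).
  by apply: continuous_minr => //; exact: continuous_cst.
have h1_ge0 u : 0 <= Num.min (h u) 1 by rewrite le_min h0 ler01.
have Qg u : (\int[Q u]_s (g s)%:E = (Num.min (h u) 1)%:E)%E.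
  rewrite section_kernel_integral//.
  - by rewrite /g/= integral_cst// prob_kernel mule1.
  - by apply/measurable_EFinP; exact: continuous_borel_measurable.
  - by move=> s; rewrite lee_fin h1_ge0.
have Lg : L g = 0.
  apply: limL; rewrite (_ : (fun u => _) = (fun u => Num.min (h u) 1));
    last first.
    by apply/funext => u; rewrite /Rintegral Qg.
  have -> : 0 = Num.min (h u0) 1 by rewrite (iffRL (hu0 u0) erefl) min_l.
  by move=> A /ch1 /Uu0.
have mh1 : measurable_fun [set: borel X] (fun u => (Num.min (h u) 1)%:E).
  by apply/measurable_EFinP; exact: continuous_borel_measurable.
have int0 : (\int[m]_u `|(Num.min (h u) 1)%:E| = 0)%E.
  under eq_integral do rewrite gee0_abs ?lee_fin ?h1_ge0// -Qg.
  rewrite -(mixture_integral measurable_section_kernel nuQ).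
  - by rewrite EFin_Rintegral_continuous// nuE// Lg.
  - by apply/measurable_EFinP; exact: continuous_borel_measurable.
  - by move=> s; rewrite lee_fin /g h1_ge0.
have m0 := (ae_eq_integral_abs m measurableT mh1).1 int0.
(* Mixing the [Q u] by a measure carried by [u0] gives [Q u0]; the limit of [F] along [U] is then
   [F u0], against the gap [e] on [E]. *)
have nuQu0 : F u0 = L f.
  rewrite -nuE//; congr fine; apply: eq_measure_integral => A mA _.
  rewrite [RHS]nuQ// (ae_eq_integral (cst (Q u0 A)))//.
  - exact: (esym (integral_probability_cst m (Q u0 A))).
  - exact: measurable_section_kernel.
  - move: m0; apply: filterS => u /(_ I) /= /eqP; rewrite eqe => /eqP.
    have [h1 h_0 _|_ /eqP] := ltP (h u) 1; last by rewrite oner_eq0.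
    by rewrite (iffLR (hu0 u) h_0).
have Ff : (F u @[u --> U]) --> F u0 by rewrite nuQu0; exact: cvgL.
have UF : U [set u | `|F u0 - F u| < e] by move/cvgrPdist_lt : Ff => /(_ e e0).
have UEF : U (E `&` [set u | `|F u0 - F u| < e]) by exact: filterI.
have [u []] := filter_ex UEF.
by rewrite /E/= leNgt => /negP.
Unshelve. all: by end_near.
Qed.

End feller.
(** * Penalised selectors *)

Section penalised_duality.
Variables (R : realType) (d : measure_display) (S : measurableType d).
Variables (X : ptopologicalType) (mu : probability S R).
Variables (x : nat -> X) (basisX : nat -> set X) (e : nat -> X -> R).
Hypothesis cptX : compact [set: X].
Hypothesis dense_x : forall U, open U -> U !=set0 -> exists n, U (x n).
Hypothesis bX : open_basis basisX.
Hypothesis ce : forall n, continuous (e n).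
Hypothesis eB : forall n u, 0 < e n u <-> basisX n u.
Variables (L : X -> R) (C : S -> X -> R) (B : R).
Hypothesis cL : continuous L.
Hypothesis cC : caratheodory_fun C.
Hypothesis B0 : 0 < B.
Hypothesis LB : forall u, `|L u| <= B.
Hypothesis C01 : forall s u, 0 <= C s u <= B.

Definition selector (sigma : S -> X) : Prop :=
  [/\ measurable_fun setT (sigma : S -> borel X),
    measurable_fun setT (fun s => C s (sigma s)) &
    measurable_fun setT (fun s => L (sigma s))].

Definition cost (sigma : S -> X) : R := \int[mu]_s C s (sigma s).
Definition reward (sigma : S -> X) : R := \int[mu]_s L (sigma s).

Lemma penalised_selector (lam : R) : exists sigma, selector sigma /\
  forall s u, L u - lam * C s u <= L (sigma s) - lam * C s (sigma s).
Proof.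
have [mC ctC] := cC.
have cf0 : caratheodory_fun (fun s u => lam * C s u - L u).
  split=> [u|s].
    by apply: measurable_funB; [exact: measurable_funM (measurable_cst _)
      (mC u)|exact: measurable_cst].
  by apply: continuous_subr => //; exact: continuous_scaler.
have [sigma [ms m0 m1 sP _]] :=
  measurable_argmin_selection cptX dense_x bX ce eB cf0 cC.
exists sigma; split; last by move=> s u; have := sP s u; lra.
(* The selection makes [lam * C - L] and [C] measurable along [sigma]; [L] is obtained by
   difference. *)
split=> //; rewrite (_ : (fun s => _) = (fun s =>
  lam * C s (sigma s) - (lam * C s (sigma s) - L (sigma s)))).
  by apply: measurable_funB => //; exact: measurable_funM (measurable_cst _) m1.
by apply/funext => s; rewrite opprB addrC subrK.
Qed.

Lemma cheapest_selector : exists sigma, [/\ selector sigma,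
  forall s u, C s (sigma s) <= C s u &
  forall s u, C s u = C s (sigma s) -> L u <= L (sigma s)].
Proof.
have cf1 : caratheodory_fun (fun (_ : S) u => - L u).
  split=> [u|s]; first exact: measurable_cst.
  by move=> u; apply: cvgN; exact: cL.
have [sigma [ms m0 m1 sP sL]] :=
  measurable_argmin_selection cptX dense_x bX ce eB cC cf1.
exists sigma; split=> //; last by move=> s u /sL; rewrite lerN2.
split=> //; rewrite (_ : (fun s => _) = (fun s => - - L (sigma s))).
  exact: measurableT_comp.
by apply/funext => s; rewrite opprK.
Qed.

Lemma bounded_probability_integrable (f : S -> R) (M : R) :
  measurable_fun setT f -> (forall s, `|f s| <= M) ->
  mu.-integrable setT (EFin \o f).
Proof.
move=> mf fM; apply: measurable_bounded_integrable => //.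
  exact: (le_lt_trans (probability_le1 mu measurableT) (ltry _)).
by exists M; split; [exact: num_real|move=> r Mr s _; exact: le_trans (ltW Mr)].
Qed.

Lemma cost_integrable sigma : selector sigma ->
  mu.-integrable setT (EFin \o (fun s => C s (sigma s))).
Proof.
move=> [_ mC _]; apply: (bounded_probability_integrable mC (M := B)) => s.
by have /andP[C0 C1] := C01 s (sigma s); rewrite ger0_norm.
Qed.

Lemma reward_integrable sigma : selector sigma ->
  mu.-integrable setT (EFin \o (fun s => L (sigma s))).
Proof. by move=> [_ _ mL]; exact: (bounded_probability_integrable mL). Qed.

Lemma penalised_integrable sigma lam : selector sigma ->
  mu.-integrable setT (EFin \o (fun s => L (sigma s) - lam * C s (sigma s))).
Proof.
move=> ss; have := integrableB measurableT (reward_integrable ss)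
  (integrableZl measurableT lam (cost_integrable ss)).
exact.
Qed.

Lemma penalised_RintegralE sigma lam : selector sigma ->
  \int[mu]_s (L (sigma s) - lam * C s (sigma s)) = reward sigma - lam * cost
    sigma.
Proof.
move=> ss; rewrite RintegralB//; last 2 first.
- exact: reward_integrable.
- exact: (integrableZl measurableT lam (cost_integrable ss)).
by rewrite RintegralZl//; exact: cost_integrable.
Qed.

Lemma le_penalised sigma tau lam : selector sigma -> selector tau ->
  (forall s u, L u - lam * C s u <= L (sigma s) - lam * C s (sigma s)) ->
  reward tau - lam * cost tau <= reward sigma - lam * cost sigma.
Proof.
move=> ss st opt; rewrite -!penalised_RintegralE//.
by apply: le_Rintegral => //; exact: penalised_integrable.
Qed.

Lemma cost_bounds sigma : selector sigma -> 0 <= cost sigma <= B.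
Proof.
move=> ss; apply/andP; split.
  by apply: Rintegral_ge0 => s _; have /andP[] := C01 s (sigma s).
rewrite -[leRHS](Rintegral_probability_cst mu); apply: le_Rintegral => //.
- exact: cost_integrable.
- by apply: (@bounded_probability_integrable (fun=> B) B) => // s;
  rewrite gtr0_norm.
- by move=> s _; have /andP[] := C01 s (sigma s).
Qed.

(** Comparison with [sg] gives [L (sg s) <= L (tau n s)]. By compactness, points whose [L] exceeds
    [L (sg s)] by [r] have a cost excess of at least some [1/(k+1)], too expensive for large
    [lam n]. Dominated convergence concludes. *)
Lemma reward_cvg (sg : S -> X) (lam : nat -> R) (tau : nat -> S -> X) :
  selector sg -> (forall s u, C s (sg s) <= C s u) ->
  (forall s u, C s u = C s (sg s) -> L u <= L (sg s)) ->
  (forall n, n%:R <= lam n) -> (forall n, selector (tau n)) ->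
  (forall n s u, L u - lam n * C s u <= L (tau n s) - lam n * C s (tau n s)) ->
  (fun n => reward (tau n)) @ \oo --> reward sg.
Proof.
move=> ssg Cmin Lmax lamn stau opt.
have pw s : (fun n => L (tau n s)) @ \oo --> L (sg s).
  apply/cvgrPdist_lt => r r0.
  have lbn n : L (sg s) <= L (tau n s).
    have := opt n s (sg s); have := Cmin s (tau n s) => h1 h2.
    have : 0 <= lam n * (C s (tau n s) - C s (sg s)).
      by rewrite mulr_ge0 ?subr_ge0// (le_trans _ (lamn n)).
    by rewrite mulrBr; lra.
  have [|||k kV] := @compact_increasing_cover X setT (fun k =>
     [set u | C s (sg s) + k.+1%:R^-1 < C s u] `|` [set u | L u < L (sg s) +
       r]) cptX.
  - move=> k; apply: openU; last exact: continuous_open_ltr.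
    exact: (continuous_open_gtr _ (cC.2 s)).
  - move=> m n mn u [/= Cu|]; [left|by right]; apply: le_lt_trans Cu.
    by rewrite lerD2l lef_pV2 ?posrE// ler_nat ltnS.
  - move=> u _; have [Ce|Cne] := eqVneq (C s u) (C s (sg s)).
      by exists 0%N => //; right => /=;
        rewrite (le_lt_trans (Lmax _ _ Ce))// ltrDl.
    have /ltr_add_invr[k Ck] : C s (sg s) < C s u by rewrite lt_neqAle eq_sym
      Cne Cmin.
    by exists k => //; left.
  near=> n.
  have n0 : (0 < n%:R :> R) by rewrite ltr0n; near: n; exact: nbhs_infty_gt.
  (* The penalty of a cost excess [1/(k+1)] then reaches [2 * B], a bound for every gain in [L]. *)
  have Bn : 2 * B * k.+1%:R <= n%:R by near: n; exact: nbhs_infty_ger.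
  have [/=|/= Lt] := kV (tau n s) I; last first.
    by rewrite distrC ger0_norm ?subr_ge0// ltrBlDl.
  move=> Ck; exfalso.
  have h1 := opt n s (sg s).
  have lam0 : 0 < lam n by exact: lt_le_trans (lamn n).
  have h2 : lam n * (C s (tau n s) - C s (sg s)) <= 2 * B.
    rewrite mulrBr; have := LB (tau n s); have := LB (sg s).
    by rewrite !ler_norml => /andP[? ?] /andP[? ?]; lra.
  have : lam n * k.+1%:R^-1 < 2 * B.
    by apply: lt_le_trans h2; rewrite ltr_pM2l// ltrBrDl.
  rewrite ltNge => /negP; apply.
  by rewrite ler_pdivlMr// (le_trans Bn).
have intE (tau' : S -> X) : selector tau' ->
  (\int[mu]_s (L (tau' s))%:E)%E = (reward tau')%:E.
  move=> st; rewrite /reward /Rintegral fineK//.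
  exact: (integrable_fin_num measurableT (reward_integrable st)).
have [|||||_ _] := @dominated_convergence _ _ _ mu setT measurableT
    (fun n s => (L (tau n s))%:E) (fun s => (L (sg s))%:E) (cst B%:E).
- by move=> n; apply/measurable_EFinP; have [] := stau n.
- by apply/measurable_EFinP; have [] := ssg.
- by apply: aeW => s _; apply: cvg_EFin; [exact: nearW|exact: pw].
- apply: (@bounded_probability_integrable (fun=> B) B) => // s.
  by rewrite gtr0_norm.
- by apply: aeW => s n _; rewrite lee_fin.
rewrite intE//.
under eq_fun do rewrite intE//.
by move/fine_cvgP => [].
Unshelve. all: by end_near.
Qed.

Lemma penalised_duality (eps : R) :
  (forall sg, selector sg -> (forall s u, C s (sg s) <= C s u) ->
    cost sg <= eps) ->
  forall delta, 0 < delta -> exists lam sigma s1 s2 t,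
  [/\ 0 <= lam, [/\ selector sigma, selector s1 & selector s2], 0 <= t <= 1,
    (forall s u, L u - lam * C s u <= L (sigma s) - lam * C s (sigma s)) &
    t * cost s1 + (1 - t) * cost s2 <= eps /\
    lam * eps + \int[mu]_s (L (sigma s) - lam * C s (sigma s)) <=
      t * reward s1 + (1 - t) * reward s2 + delta].
Proof.
move=> cheap delta delta0.
have [sig sigP] := choice penalised_selector.
have ssig lam : selector (sig lam) by case: (sigP lam).
have osig lam s u : L u - lam * C s u <= L (sig lam s) - lam * C s (sig lam s).
  by case: (sigP lam).
(* The multipliers whose selector is too expensive. Three cases: [Lam] is unbounded, 0 is outside
   [Lam], or [Lam] has a supremum. *)
pose Lam := [set lam | 0 <= lam /\ eps < cost (sig lam)].
have [[M LamM]|unb] := pselect (exists M, ubound Lam M); last first.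
  have /choice[lam lamP] n : exists lam, n%:R <= lam /\ Lam lam.
    apply: contrapT => /forallNP h; apply: unb; exists n%:R => lam Llam.
    by rewrite leNgt; apply/negP => nl; apply: (h lam); split=> //; exact: ltW.
  have [sg [ssg Cmin Lmax]] := cheapest_selector.
  have cv := reward_cvg ssg Cmin Lmax (fun n => (lamP n).1)
    (fun n => ssig (lam n)) (fun n => osig (lam n)).
  have /cvgrPdist_lt /(_ _ delta0) [n _ /(_ n (leqnn n)) /=] := cv.
  rewrite ltr_norml => /andP[h _].
  have [_ [lam0 epsc]] := lamP n.
  exists (lam n), (sig (lam n)), sg, sg, 1; split=> //.
    by rewrite ler01 lexx.
  rewrite subrr !mul0r !addr0 !mul1r; split; first exact: cheap.
  rewrite penalised_RintegralE//.
  have : lam n * eps <= lam n * cost (sig (lam n)) by rewrite ler_wpM2l// ltW.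
  by lra.
have [L0|nL0] := pselect (Lam 0); last first.
  exists 0, (sig 0), (sig 0), (sig 0), 1; split=> //.
    by rewrite ler01 lexx.
  rewrite subrr !mul0r !addr0 !mul1r add0r; split.
    by rewrite leNgt; apply/negP => h; apply: nL0.
  by rewrite penalised_RintegralE// mul0r subr0 lerDl ltW.
have hL : has_sup Lam by split; [exists 0|exists M].
(* [lam1] and [lam2] will differ by less than [2 * eta]; times a cost, which is at most [B], this is
   at most [delta]. *)
pose eta := delta / (2 * B).
have eta0 : 0 < eta by rewrite divr_gt0// mulr_gt0.
have [lam1 [lam1_ge0 a1] lam1s] := sup_adherent eta0 hL.
have lam1_le : lam1 <= sup Lam by apply: (ub_le_sup hL.2).
pose lam2 := sup Lam + eta.
have a2 : cost (sig lam2) <= eps.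
  rewrite leNgt; apply/negP => a2.
  have : lam2 <= sup Lam.
    apply: (ub_le_sup hL.2); split=> //.
    by rewrite /lam2 addr_ge0 ?(ltW eta0)// (le_trans lam1_ge0).
  by rewrite leNgt /lam2 ltrDl eta0.
set c1 := cost (sig lam1) in a1; set c2 := cost (sig lam2) in a2.
have c12 : 0 < c1 - c2 by rewrite subr_gt0 (le_lt_trans a2).
(* The weight at which the mixed cost is exactly [eps]. *)
pose t := (eps - c2) / (c1 - c2).
have t0 : 0 <= t by apply: divr_ge0; [rewrite subr_ge0|exact: ltW].
have t1 : t <= 1 by rewrite ler_pdivrMr// mul1r lerD2r ltW.
have tE : t * c1 + (1 - t) * c2 = eps.
  have : t * (c1 - c2) = eps - c2 by rewrite divfK// gt_eqF.
  by rewrite mulrBr mulrBl mul1r; lra.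
exists lam1, (sig lam1), (sig lam1), (sig lam2), t; split=> //.
  by rewrite t0.
rewrite tE; split=> //; rewrite penalised_RintegralE// -/c1.
set b1 := reward (sig lam1); set b2 := reward (sig lam2).
have := le_penalised (ssig lam2) (ssig lam1) (osig lam2).
rewrite -/c1 -/c2 -/b1 -/b2 => opt.
have /andP[c10 c1B] := cost_bounds (ssig lam1).
have /andP[c20 c2B] := cost_bounds (ssig lam2).
rewrite -/c1 in c10 c1B; rewrite -/c2 in c20 c2B.
have l12 : 0 <= lam2 - lam1 by rewrite subr_ge0 /lam2 (le_trans lam1_le)//
  lerDl ltW.
have l12e : (lam2 - lam1) * B <= delta.
  apply: (@le_trans _ _ (2 * eta * B)).
    by rewrite ler_pM2r// /lam2; move: lam1s; lra.
  by rewrite /eta mulrAC mulrCA mulfV ?mulr1// gt_eqF// mulr_gt0.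
have k1 : (lam2 - lam1) * c1 <= delta.
  by apply: le_trans l12e; exact: ler_wpM2l.
have k2 : 0 <= (lam2 - lam1) * c2 by exact: mulr_ge0.
(* Optimality of [sig lam2] against [sig lam1], rewritten with [lam1] in place of [lam2] at the
   price of [delta]. *)
have k3 : lam1 * c2 + (b1 - lam1 * c1) <= b2 + delta.
  by move: k1 k2 opt; rewrite !mulrBl; lra.
have k4 : (1 - t) * (lam1 * c2 + (b1 - lam1 * c1)) <= (1 - t) * (b2 + delta).
  by rewrite ler_wpM2l// subr_ge0.
have -> : lam1 * eps + (b1 - lam1 * c1) =
    t * b1 + (1 - t) * (lam1 * c2 + (b1 - lam1 * c1)) by rewrite -tE; ring.
have : (1 - t) * delta <= delta by rewrite ler_piMl ?(ltW delta0)//; lra.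
by move: k4; rewrite mulrDr; lra.
Qed.

End penalised_duality.
(** * Duality *)

Section lower_integral.
Variables (R : realType) (d : measure_display) (T : measurableType d).
Variable mu : probability T R.
Local Open Scope ereal_scope.

(** For nonnegative functions, measurable or not, the integral is a supremum over the simple
    functions below. *)
Lemma le_lower_integral (f g : T -> \bar R) : (forall x, 0 <= f x) ->
  (forall x, f x <= g x) -> \int[mu]_x f x <= \int[mu]_x g x.
Proof.
move=> f0 fg; have g0 x : 0 <= g x by rewrite (le_trans (f0 x)).
rewrite !ge0_integralTE//; apply: ge_ereal_sup => _ [h hf <-].
by apply: ereal_sup_ubound; exists h => // x; rewrite (le_trans (hf x)).
Qed.

Import HBNNSimple.

(* [f] and [g] need not be measurable: for a simple [h <= f] the measurable
   function [(h - p)^+] lies below [lam * g] off a null set. *)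
Lemma lower_integral_affine_le (f g p : T -> R) (lam eps : R) :
  (forall x, 0 <= f x)%R -> (forall x, 0 <= g x)%R -> (0 <= lam)%R ->
  mu.-integrable setT (EFin \o p) ->
  {ae mu, forall x, f x <= lam * g x + p x}%R ->
  \int[mu]_x (g x)%:E <= eps%:E ->
  \int[mu]_x (f x)%:E <= (lam * eps)%:E + \int[mu]_x (p x)%:E.
Proof.
move=> f0 g0 lam0 ip [N [mN N0 fN]] geps.
rewrite ge0_integralTE; last by move=> x; rewrite lee_fin.
apply: ge_ereal_sup => _ [h hf <-].
have mp : measurable_fun setT p by apply/measurable_EFinP;
  exact: measurable_int ip.
rewrite -integralT_nnsfun.
have mh : measurable_fun setT h by [].
pose q x := (Num.max (h x - p x) 0)%R.
have mq : measurable_fun setT q.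
  by apply: measurable_maxr; [exact: measurable_funB|exact: measurable_cst].
have q0 x : (0 <= q x)%R by rewrite le_max lexx orbT.
pose t x := (q x * \1_(~` N) x)%R.
have mt : measurable_fun setT t.
  by apply: measurable_funM => //; exact/measurable_indic/measurableC.
have t0 x : (0 <= t x)%R by rewrite mulr_ge0.
have tg x : (t x <= lam * g x)%R.
  rewrite /t indicE; case: (boolP (x \in _)) => [|_];
    last by rewrite mulr0 mulr_ge0.
  rewrite inE => Nx; rewrite mulr1 ge_max mulr_ge0// andbT lerBlDr.
  have hfx : (h x <= f x)%R by rewrite -lee_fin; exact: hf.
  by apply: (le_trans hfx); apply: contrapT => nf; apply: Nx; exact: fN.
have t_eps : \int[mu]_x (t x)%:E <= (lam * eps)%:E.
  (* Scaling is performed on the measurable [t], and [lam^-1 * t] is then compared with [g]; for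
     [lam = 0] the function [t] vanishes. *)
  have [lam00|lamn0] := eqVneq lam 0%R.
    rewrite lam00 mul0r integral0_eq// => x _; congr EFin; apply/le_anti.
    by rewrite t0 andbT (le_trans (tg x))// lam00 mul0r.
  have lam_gt0 : (0 < lam)%R by rewrite lt_neqAle eq_sym lamn0.
  have -> : \int[mu]_x (t x)%:E = lam%:E * \int[mu]_x (lam^-1 * t x)%:E.
    rewrite -ge0_integralZl//.
    - by apply: eq_integral => x _; rewrite -EFinM mulVKf.
    - by apply/measurable_EFinP; exact: measurable_funM.
    - by move=> x _; rewrite lee_fin mulr_ge0// invr_ge0.
  rewrite EFinM lee_pmul2l//; apply: le_trans geps.
  apply: le_lower_integral => x; rewrite lee_fin.
    by rewrite mulr_ge0// invr_ge0.
  by rewrite ler_pdivrMl.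
have qt : \int[mu]_x (q x)%:E = \int[mu]_x (t x)%:E.
  apply: ge0_ae_eq_integral => //.
  - exact/measurable_EFinP.
  - exact/measurable_EFinP.
  - by move=> x _; rewrite lee_fin.
  - by move=> x _; rewrite lee_fin.
  exists N; split => // x /= /not_implyP[_ qtx]; apply: contrapT => nNx;
    apply: qtx.
  by rewrite /t indicE mem_set ?mulr1.
have iq : mu.-integrable setT (EFin \o q).
  apply/integrableP; split; first exact/measurable_EFinP.
  under eq_integral do rewrite gee0_abs ?lee_fin//=.
  by rewrite qt (le_lt_trans t_eps)// ltry.
apply: (@le_trans _ _ (\int[mu]_x ((q x)%:E + (p x)%:E))).
  apply: le_lower_integral => x; rewrite lee_fin//.
  by rewrite -lerBlDr le_max lexx.
by rewrite integralD// qt leeD2r.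
Qed.

End lower_integral.

(** * Mixtures of selectors as kernels *)

Lemma probability_mixture d (T : measurableType d) (R : realType)
    (P1 P2 : probability T R) (t : R) : 0 <= t <= 1 ->
  exists P : probability T R,
    (forall A, measurable A -> P A = (t%:E * P1 A + (1 - t)%:E * P2 A)%E) /\
    forall f : T -> \bar R, measurable_fun setT f -> (forall x, (0 <= f x)%E) ->
      (\int[P]_x f x = t%:E * \int[P1]_x f x + (1 - t)%:E * \int[P2]_x f x)%E.
Proof.
move=> /andP[t0 t1]; have t'0 : 0 <= 1 - t by rewrite subr_ge0.
pose m := measure_add (mscale (NngNum t0) P1) (mscale (NngNum t'0) P2).
have mE A : m A = (t%:E * P1 A + (1 - t)%:E * P2 A)%E by exact: measure_addE.
have [||||P PE] := @probability_of_set_function _ T R m.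
- exact: measure0.
- by move=> A; exact: measure_ge0.
- exact: measure_semi_sigma_additive.
- rewrite mE; transitivity (t%:E * 1 + (1 - t)%:E * 1 : \bar R)%E.
    by congr (_ * _ + _ * _)%E; exact: probability_setT.
  by rewrite !mule1 -EFinD addrC subrK.
exists P; split=> [A _|f mf f0]; first by rewrite PE.
transitivity (\int[m]_x f x)%E.
  by apply: eq_measure_integral => A _ _; exact: PE.
by rewrite ge0_integral_measure_add// !ge0_integral_mscale.
Qed.

Section structured_kernel.
Variables (R : realType) (X Y : ptopologicalType).
Variable kap : R.-pker (borel X) ~> (borel Y).
Variable Q : X -> borel_prob (X * Y)%type R.
Hypotheses (hX : polish R X) (hY : polish R Y) (hS : polish R (X * Y)%type).
Hypothesis cptS : compact [set: X * Y].
Hypothesis QE : forall u A, Q u A = kap u (xsection A u).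

Lemma compact_fst : compact [set: X].
Proof.
have -> : [set: X] = fst @` [set: X * Y].
  by apply/seteqP; split => // u _; exists (u, point).
apply: continuous_compact => //; apply: continuous_subspaceT => s.
exact: cvg_fst.
Qed.

(** The sign of [h] is free here, as the integrand [l - lam * c] of [phi] may be negative;
    boundedness provides integrability. *)
Lemma section_kernel_EFin (h : X * Y -> R) (u : X) : continuous h ->
  (\int[kap u]_v (h (u, v))%:E = (\int[Q u]_s h s)%:E)%E.
Proof.
move=> ch; rewrite -(EFin_Rintegral_continuous _ cptS ch).
have mp := @measurable_section X Y u.
have mh : measurable_fun [set: borel (X * Y)%type] (EFin \o h).
  by apply/measurable_EFinP; exact: continuous_borel_measurable.
have -> : (\int[Q u]_s (h s)%:E = \int[pushforward (kap u)
    ((fun v => (u, v)) : borel Y -> borel (X * Y)%type)]_s (h s)%:E)%E.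
  apply: eq_measure_integral => A mA _.
  exact: (etrans (QE u A) (congr1 (kap u) (xsection_preimage A u))).
rewrite (@integral_pushforward _ _ (borel Y) (borel (X * Y)%type))//.
have [B [B0 hB]] := compact_bounded_continuous cptS ch.
apply: (@measurable_bounded_integrable _ (borel Y) R (kap u));
  rewrite ?preimage_setT//.
- by rewrite prob_kernel ltry.
- exact: (measurableT_comp (continuous_borel_measurable ch) mp).
- by exists B; split; [exact: num_real|move=> r Br v _;
  exact: le_trans (ltW Br)].
Qed.

Lemma kernel_product_integral (m : borel_prob X R)
    (nu : borel_prob (X * Y)%type R) (h : X * Y -> R) :
  is_kernel_product kap m nu -> continuous h -> (forall s, 0 <= h s) ->
  (\int[nu]_s (h s)%:E = \int[m]_u (\int[Q u]_s h s)%:E)%E.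
Proof.
move=> mnu ch h0.
rewrite (mixture_integral (measurable_section_kernel hX hY QE) (m := m)).
- by apply: eq_integral => u _; exact: EFin_Rintegral_continuous.
- by move=> A mA; rewrite mnu//; apply: eq_integral => u _; rewrite QE.
- by apply/measurable_EFinP; exact: continuous_borel_measurable.
- by move=> s; rewrite lee_fin.
Qed.

Lemma mixed_selector_kernel (mu : borel_prob (X * Y)%type R)
    (s1 s2 : X * Y -> X) (t : R) : 0 <= t <= 1 ->
  measurable_fun [set: borel (X * Y)%type] (s1 : _ -> borel X) ->
  measurable_fun [set: borel (X * Y)%type] (s2 : _ -> borel X) ->
  exists pi : X * Y -> borel_prob (X * Y)%type R,
    kernel_in mu (K_of kap) pi /\
    forall s (h : X * Y -> R), continuous h -> (forall r, 0 <= h r) ->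
      (\int[pi s]_r (h r)%:E = (t * \int[Q (s1 s)]_r h r +
        (1 - t) * \int[Q (s2 s)]_r h r)%:E)%E.
Proof.
move=> t01 ms1 ms2.
have mQ := measurable_section_kernel hX hY QE.
have /choice[pi piP] s := probability_mixture (Q (s1 s)) (Q (s2 s)) t01.
exists pi; split; last first.
  move=> s h ch h0; rewrite (piP s).2//.
  - by rewrite !EFin_Rintegral_continuous.
  - by apply/measurable_EFinP; exact: continuous_borel_measurable.
split.
  move=> A mA B mB.
  (* The kernel is Borel measurable, so the negligible part can be empty. *)
  exists ((fun s => pi s A) @^-1` B); last by exists set0;
    [exact: negligible_set0|rewrite setU0].
  rewrite -[X in measurable X]setTI.
  suff : measurable_fun [set: borel (X * Y)%type] (fun s => pi s A) by exact.
  rewrite (_ : (fun s => _) = (fun s =>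
    (t%:E * Q (s1 s) A + (1 - t)%:E * Q (s2 s) A)%E)).
    apply: emeasurable_funD; apply: measurable_funeM.
      exact: (measurableT_comp (mQ A mA) ms1).
    exact: (measurableT_comp (mQ A mA) ms2).
  by apply/funext => s; rewrite (piP s).1.
apply: aeW => s.
(* The first marginal is the mixture of the Dirac masses at [s1 s] and [s2 s]. *)
have [m [_ mint]] := probability_mixture (\d_(s1 s : borel X) : borel_prob X R)
  (\d_(s2 s : borel X) : borel_prob X R) t01.
exists m => A mA; rewrite (piP s).1//.
have mk : measurable_fun [set: borel X] (fun u => kap u (xsection A u)).
  rewrite (_ : (fun u => _) = (fun u => Q u A)); first exact: mQ.
  by apply/funext => u; rewrite QE.
rewrite mint//.
by rewrite !integral_dirac// !diracT !mul1e !QE.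
Qed.

End structured_kernel.

(** * The two inequalities of the duality formula *)

Lemma ae_weaken d (T : measurableType d) (R : realType) (P : probability T R)
    (H1 H2 : T -> Prop) : {ae P, forall x, H1 x} ->
  (forall x, H1 x -> H2 x) -> {ae P, forall x, H2 x}.
Proof. by move=> + H12; apply: filterS. Qed.

Lemma ae_exists d (T : measurableType d) (R : realType) (P : probability T R)
    (H : T -> Prop) : {ae P, forall x, H x} -> exists x, H x.
Proof.
move=> [N [mN N0 HN]]; apply: contrapT => /forallNP nH.
have NT : N = setT by apply/seteqP; split=> // x _; apply: HN; exact: nH.
move: N0; rewrite NT (@probability_setT _ _ _ P) => /eqP.
by rewrite eqe oner_eq0.
Qed.

Theorem theorem3p4 (R : realType) (X Y : ptopologicalType)
  (hX : polish R X) (hY : polish R Y) (hS : polish R (X * Y)%type)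
  (cptS : compact [set: X * Y])
  (dG : measure_display) (GG : measurableType dG)
  (mu : borel_prob (X * Y)%type R) (eps : R) (heps : 0 <= eps) (G : GG)
  (kap : R.-pker (borel X) ~> (borel Y))
  (c : X * Y -> X * Y -> R)
  (c_ge0 : forall s r, 0 <= c s r)
  (c_cont : continuous (fun p : (X * Y) * (X * Y) => c p.1 p.2))
  (c_eq0 : forall s r, c s r = 0 <-> s = r)
  (l : X * Y -> GG -> R)
  (l_ge0 : forall s g, 0 <= l s g)
  (l_meas : measurable_fun [set: borel (X * Y)%type * GG]
     (fun p : borel (X * Y)%type * GG => l p.1 p.2))
  (l_cont : continuous (fun s => l s G))
  (hK : {ae mu, forall s, [/\ K_of kap s !=set0,
     weak_star_closed (K_of kap s) & convex_subset (K_of kap s)]})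
  (hOmega : Omega mu (K_of kap) c eps !=set0) :
  I_Omega mu (K_of kap) l c eps G =
  ereal_inf [set ((lam * eps)%:E + \int[mu]_s phi kap l c lam G s)%E
            | lam in [set lam : R | 0 <= lam]].

Proof.
have [Q QE] := section_kernel kap.
(* [K_of kap s] is the same set for every [s], so closedness at a single point gives it
   everywhere. *)
have [s0 [_ cK _]] := ae_exists hK.
have feller := section_kernel_feller hX hY hS cptS QE cK.
have cptX := compact_fst cptS.
have [x dense_x] := separable_sequence hX.1.
have [BX bX] := polish_basis hX.
have [BS bS] := polish_basis hS.
have /choice[e eP] n := polish_cozero hX (bX.1 n).
have ce n : continuous (e n) by case: (eP n).
have eB n u : 0 < e n u <-> BX n u by case: (eP n).
have cc s : continuous (c s).
  move=> r; have := @continuous_comp _ _ _ (fun r => (s, r))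
    (fun p : (X * Y) * (X * Y) => c p.1 p.2) r; apply; last exact: c_cont.
  exact: (@continuous_section (X * Y)%type (X * Y)%type s).
pose lG r := l r G.
pose L u := \int[Q u]_r lG r.
pose C s u := \int[Q u]_r c s r.
have cL : continuous L by exact: feller.
have cptSS : compact [set: (X * Y) * (X * Y)].
  by rewrite -setXTT; exact: compact_setX.
have [B1 [B10 lB]] := compact_bounded_continuous cptS l_cont.
have [B2 [B20 cB]] := compact_bounded_continuous cptSS c_cont.
pose B := Num.max B1 B2.
have B0 : 0 < B by rewrite lt_max B10.
have LB u : `|L u| <= B.
  by apply: Rintegral_continuous_bound => // s; rewrite le_max lB.
have C_ge0 s u : 0 <= C s u by apply: Rintegral_ge0 => r _; exact: c_ge0.
have C01 s u : 0 <= C s u <= B.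
  rewrite C_ge0/= (le_trans (ler_norm _))//.
  by apply: Rintegral_continuous_bound => // r; rewrite le_max (cB (s, r)) orbT.
have cC : caratheodory_fun (C : borel (X * Y)%type -> X -> R).
  split=> [u|s]; last exact: (feller _ (cc s)).
  (* Tonelli asks for the product sigma-algebra, which a countable basis of the space relates to the
     Borel one. *)
  have mc : measurable_fun [set: borel (X * Y)%type * borel (X * Y)%type]
      (fun p => (c p.1 p.2)%:E).
    by apply/measurable_EFinP; exact: (continuous_prod_measurable bS bS c_cont).
  apply/measurable_EFinP.
  rewrite (_ : _ \o _ = (fun s => \int[Q u]_r (c s r)%:E)%E).
    have := @measurable_fun_fubini_tonelli_F _ _ (borel (X * Y)%type)
      (borel (X * Y)%type) R (Q u) (fun p => (c p.1 p.2)%:E) mc.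
    by apply => p; rewrite lee_fin.
  by apply/funext => s; rewrite /= EFin_Rintegral_continuous.
have phiE lam (sigma : X * Y -> X) s :
    (forall u, L u - lam * C s u <= L (sigma s) - lam * C s (sigma s)) ->
    phi kap l c lam G s = (L (sigma s) - lam * C s (sigma s))%:E.
  move=> opt.
  have int u : (\int[kap u]_v (l (u, v) G - lam * c s (u, v))%:E =
      (L u - lam * C s u)%:E)%E.
    have clc : continuous (fun r => lam * c s r) by exact: continuous_scaler.
    rewrite (section_kernel_EFin cptS QE (h := fun r => lG r - lam * c s r)).
      rewrite RintegralB//; [|exact: continuous_integrable|exact:
        continuous_integrable].
      by rewrite RintegralZl//; exact: continuous_integrable.
    exact: continuous_subr.
  apply/le_anti/andP; split.
    by apply: ge_ereal_sup => _ [u _ <-]; rewrite int lee_fin.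
  by apply: ereal_sup_ubound; exists (sigma s); rewrite ?int.
have clG : continuous lG by exact: l_cont.
have lG_ge0 r : 0 <= lG r by exact: l_ge0.
have KH s nu : K_of kap s nu -> exists m : borel_prob X R,
    forall h : X * Y -> R, continuous h -> (forall r, 0 <= h r) ->
      \int[nu]_r h r = \int[m]_u \int[Q u]_r h r.
  move=> [m mnu]; exists m => h ch h0.
  by congr fine; exact: (kernel_product_integral hX hY cptS QE mnu).
(* A bound on [L - lam * C s] at every [u] is integrated against the first marginal of [nu]. *)
have Kpen s nu (lam p : R) : K_of kap s nu ->
    (forall u, L u - lam * C s u <= p) ->
    \int[nu]_r lG r <= lam * \int[nu]_r c s r + p.
  move=> /KH[m mE] Lp; rewrite !mE//.
  have cCs : continuous (C s) by exact: (feller _ (cc s)).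
  have iC := continuous_integrable m cptX cCs.
  have clC : continuous (fun u => lam * C s u) by exact: continuous_scaler.
  have -> : lam * \int[m]_u (\int[Q u]_r c s r) + p = \int[m]_u (lam * C s u +
    p).
    rewrite RintegralD//; last 2 first.
    - exact: continuous_integrable.
    - by apply: (continuous_integrable m cptX (f := fun=> p));
      exact: continuous_cst.
    by rewrite Rintegral_probability_cst RintegralZl.
  apply: le_Rintegral_continuous => //.
    by apply: continuous_addr => //; exact: continuous_cst.
  by move=> u; rewrite -/(L u); have := Lp u; lra.
have Kcost s nu a : K_of kap s nu -> (forall u, a <= C s u) ->
    a <= \int[nu]_r c s r.
  move=> /KH[m mE] aC; rewrite mE//.
  rewrite -[leLHS](Rintegral_probability_cst m).
  apply: le_Rintegral_continuous => //; first exact: continuous_cst.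
  exact: (feller _ (cc s)).
have intl (nu : borel_prob (X * Y)%type R) :
    (\int[nu]_r (l r G)%:E)%E = (\int[nu]_r lG r)%:E.
  exact: EFin_Rintegral_continuous.
have intc (nu : borel_prob (X * Y)%type R) s :
    (\int[nu]_r (c s r)%:E)%E = (\int[nu]_r c s r)%:E.
  by apply: EFin_Rintegral_continuous => //; exact: cc.
have c0 s (nu : borel_prob (X * Y)%type R) : 0 <= \int[nu]_r c s r.
  by apply: Rintegral_ge0 => r _; exact: c_ge0.
have l0 (nu : borel_prob (X * Y)%type R) : 0 <= \int[nu]_r lG r.
  by apply: Rintegral_ge0 => r _; exact: l_ge0.
pose sel (sigma : X * Y -> X) :=
  selector (L : X -> R) (C : borel (X * Y)%type -> X -> R) sigma.
have pen_int sigma lam : sel sigma -> mu.-integrable setT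
    (EFin \o (fun s => L (sigma s) - lam * C s (sigma s))).
  by move=> ss; exact: (penalised_integrable mu LB C01).
apply/le_anti/andP; split.
  (* Weak duality: [Kpen], with the maximal penalised value at [s] as [p], holds for almost every
     [s]. The inner integrals may fail to be Borel measurable in [s], hence the lower integrals. *)
  apply: ge_ereal_sup => _ [pi [[_ piK] pieps] <-].
  apply: le_ereal_inf_tmp => _ [lam /= lam0 <-].
  have [sigma [ss opt]] := penalised_selector cptX dense_x bX ce eB cL cC lam.
  under [X in (_ + X)%E]eq_integral => s _ do rewrite (phiE _ sigma)//.
  have -> : (\int[mu]_s \int[pi s]_r (l r G)%:E = \int[mu]_s (\int[pi s]_r lG
    r)%:E)%E.
    by apply: eq_integral => s _; exact: intl.
  apply: (@lower_integral_affine_le R _ (borel (X * Y)%type) mu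
    (fun s => \int[pi s]_r lG r) (fun s => \int[pi s]_r c s r)
    (fun s => L (sigma s) - lam * C s (sigma s)) lam eps) => //.
  - exact: pen_int.
  - by apply: (ae_weaken piK) => s Ks; exact: Kpen.
  - apply: le_trans pieps; rewrite le_eqVlt; apply/orP; left; apply/eqP.
    by apply: eq_integral => s _; exact: esym (intc _ _).
have [pi0 [[_ pi0K] pi0eps]] := hOmega.
(* At almost every [s] the cheapest selector costs no more than the feasible [pi0]; this is
   integrated as before, with multiplier 1 and [p = 0]. *)
have cheap (sg : X * Y -> X) : sel sg ->
    (forall s u, C s (sg s) <= C s u) -> cost mu (C : borel (X * Y)%type -> X ->
      R) sg <= eps.
  move=> ssg Cmin.
  have := @lower_integral_affine_le R _ (borel (X * Y)%type) mu
    (fun s => C s (sg s)) (fun s => \int[pi0 s]_r c s r) (fun=> 0) 1 eps.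
  rewrite integral0 adde0 mul1r.
  rewrite -(fineK (integrable_fin_num measurableT (cost_integrable mu C01
    ssg))).
  rewrite lee_fin; apply => //.
  - exact: integrable0.
  - by apply: (ae_weaken pi0K) => s Ks; rewrite mul1r addr0; exact: Kcost.
  - apply: le_trans pi0eps; rewrite le_eqVlt; apply/orP; left; apply/eqP.
    by apply: eq_integral => s _; exact: esym (intc _ _).
apply/lee_addgt0Pr => delta delta0.
have [lam [sigma [s1 [s2 [t [lam0 [ssig ss1 ss2] t01 opt [tc tr]]]]]]] :=
  penalised_duality cptX dense_x bX ce eB cL cC B0 LB C01 cheap delta0.
have [pi [pik piE]] := mixed_selector_kernel hX hY cptS QE mu t01
  (let: And3 h _ _ := ss1 in h) (let: And3 h _ _ := ss2 in h).
(* Taken at [C] this yields the cost of [pi], and at [L] its reward. *)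
have mix (h : X * Y -> X -> R) : (forall i : X * Y -> X, i = s1 \/ i = s2 ->
    mu.-integrable setT (EFin \o (fun s : borel (X * Y)%type => h s (i s)))) ->
    (\int[mu]_s (t * h s (s1 s) + (1 - t) * h s (s2 s))%:E =
     (t * (\int[mu]_s h s (s1 s)) + (1 - t) * (\int[mu]_s h s (s2 s)))%:E)%E.
  move=> ih; have ih1 := ih _ (or_introl erefl); have ih2 :=
    ih _ (or_intror erefl).
  have iz1 := integrableZl measurableT t ih1.
  have iz2 := integrableZl measurableT (1 - t) ih2.
  rewrite -!RintegralZl// -RintegralD// /Rintegral fineK//.
  exact: (integrable_fin_num measurableT (integrableD measurableT iz1 iz2)).
have piOmega : Omega mu (K_of kap) c eps pi.
  split=> //.
  apply: (@le_trans _ _ (\int[mu]_s (t * C s (s1 s) + (1 - t) * C s (s2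
    s))%:E)%E).
    rewrite le_eqVlt; apply/orP; left; apply/eqP; apply: eq_integral => s _.
    by apply: piE => //; exact: cc.
  rewrite mix; first by rewrite lee_fin.
  by move=> i [] ->; [exact: (cost_integrable mu C01 ss1)|exact:
    (cost_integrable mu C01 ss2)].
apply: (@le_trans _ _ ((lam * eps)%:E + \int[mu]_s phi kap l c lam G s)%E).
  by apply: ereal_inf_lbound; exists lam.
under [X in (_ + X)%E]eq_integral => s _ do rewrite (phiE _ sigma)//.
rewrite -(fineK (integrable_fin_num measurableT (pen_int _ lam ssig))) -EFinD.
apply: (@le_trans _ _ (t * reward mu L (s1 : borel (X * Y)%type -> X) +
    (1 - t) * reward mu L (s2 : borel (X * Y)%type -> X) + delta)%:E).
  by rewrite lee_fin.
rewrite EFinD leeD2r//; apply: ereal_sup_ubound; exists pi => //.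
rewrite -(mix (fun _ u => L u)); last first.
  by move=> i [] ->; [exact: (reward_integrable mu LB ss1)|exact:
    (reward_integrable mu LB ss2)].
by apply: eq_integral => s _; exact: piE.
Qed.
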